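(* Let $n\ge 1$. The triple $$\left(\mathrm{NCC}^B(n+1),\ \langle\mathrm{twist}_{2n}^2\rangle,\ \begin{bmatrix} 2n\\ n\end{bmatrix}_q\right)$$ exhibits the cyclic sieving phenomenon, where $\langle \mathrm{twist}_{2n}^2\rangle$ is regarded as an action of the cyclic group of order $n$ with generator $\mathrm{twist}_{2n}^2$.
   Context: Cyclic sieving: let $X$ be a finite set, $C_N$ a cyclic group of order $N$ with generator $g$ acting on $X$, and $f(q)$ a polynomial with non-negative integer coefficients. The triple $(X,C_N,f(q))$ exhibits the cyclic sieving phenomenon if for all $d\in\mathbb Z$, $|\{x\in X: g^d\cdot x=x\}|=f(\xi^d)$, where $\xi$ is a primitive $N$-th complex root of unity. $\begin{bmatrix} m\\ r\end{bmatrix}_q$ is the Gaussian $q$-binomial coefficient. A non-crossing $(1,2)$-configuration on $n$ vertices: place vertices $1,\dots,n$ around a circle; a configuration consists of a set of pairwise non-intersecting proper edges (chords joining two distinct vertices, pairwise non-crossing and not sharing endpoints) together with a set of loops, each loop placed on a vertex not incident to a proper edge (at most one loop per vertex). $\mathrm{NCC}^B(n+1)$ is the set of non-crossing $(1,2)$-configurations on $n$ vertices with the extra option that one of the proper edges may be marked (so each element has either no marked proper edge or exactly one). $\mathrm{rot}_n$ rotates a configuration by one step, $i\mapsto i+1\pmod n$ (the marked edge, if any, is rotated as well). The flip $\gamma$ removes the loop at vertex $1$ if there is one, adds a loop at vertex $1$ if vertex $1$ has neither a loop nor a proper edge, and does nothing if vertex $1$ is incident to a proper edge. $\mathrm{twist}_{2n}:=\mathrm{rot}_n\circ\gamma$;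 it satisfies $\mathrm{twist}_{2n}^{2n}=\mathrm{id}$. *)

(* Defs.v *)
From HB Require Import structures.
From mathcomp Require Import all_boot all_order all_algebra all_fingroup.
From mathcomp Require Import reals complex.
From mathcomp Require Import zify.

Set Implicit Arguments.
Unset Strict Implicit.
Unset Printing Implicit Defensive.

Import GRing.Theory.
Local Open Scope ring_scope.

Definition qint (k : nat) : {poly int} := \sum_(i < k) 'X^i.

Definition qfact (k : nat) : {poly int} := \prod_(i < k) qint i.+1.

(* The divisor is monic, so [%/] is the Euclidean quotient over the integers,
   without the scaling of pseudo-division. *)
Definition qbinom (m r : nat) : {poly int} :=
  if (r <= m)%N then qfact m %/ (qfact r * qfact (m - r)) else 0.

Definition expg_int (gT : finGroupType) (g : gT) (d : int) : gT :=
  match d with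
  | Posz k => (g ^+ k)%g
  | Negz k => (g ^- k.+1)%g
  end.

(* [R] ranges over the models of the real numbers, so that [R[i]] is the field
   of complex numbers. *)
Definition cyclic_sieving (R : realType) (gT : finGroupType) (C : {group gT})
    (N : nat) (g : gT) (X : finType) (to : action C X) (f : {poly int}) : Prop :=
  [/\ C :=: <[g]>%g, #|C| = N, (forall i, 0 <= f`_i) &
      forall xi : R[i], N.-primitive_root xi -> forall d : int,
        #|[set x : X | to x (expg_int g d) == x]|%:R
        = (map_poly intr f).[xi ^ d]].

Definition cycle_action (X : finType) (s : {perm X}) : action <[s]>%g X :=
  ('P \ subsetT <[s]>%g)%act.

(* The vertices 1, ..., n are represented by the elements 0, ..., n-1 of ['I_n],
   and a proper edge by the set of its two end points. A triple consists of the
   proper edges, the vertices carrying a loop, and the marked edge, if any. *)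
Definition preconf (n : nat) : finType :=
  ({set {set 'I_n}} * {set 'I_n} * option {set 'I_n})%type.

Definition noncrossing n (E : {set {set 'I_n}}) : bool :=
  [forall a : 'I_n, forall b : 'I_n, forall c : 'I_n, forall d : 'I_n,
    [&& (a < b)%N, (b < c)%N & (c < d)%N] ==>
      ~~ (([set a; c] \in E) && ([set b; d] \in E))].

Definition is_NCCB n (x : preconf n) : bool :=
  let: (E, L, m) := x in
  [&& [forall e in E, #|e| == 2],
      trivIset E,
      noncrossing E,
      [disjoint L & cover E] &
      if m is Some e then e \in E else true].

(* Indexed by the number [n] of vertices: this is the set usually written
   NCC^B(n+1). *)
Definition NCCB (n : nat) : finType := {x : preconf n | is_NCCB x}.

Definition rot_edge n (e : {set 'I_n}) : {set 'I_n} := @ordS n @: e.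

Definition rot_pre n (x : preconf n) : preconf n :=
  let: (E, L, m) := x in
  (@rot_edge n @: E, @ordS n @: L, omap (@rot_edge n) m).

Lemma rot_edge_inj n : injective (@rot_edge n).
Proof. exact: imset_inj (@ordS_inj n). Qed.

Lemma cover_rot n (E : {set {set 'I_n}}) :
  cover (@rot_edge n @: E) = @ordS n @: cover E.
Proof.
apply/setP => i; apply/bigcupP/imsetP => [[e /imsetP[e' He' ->]]|[j]].
  by case/imsetP => j Hj ->; exists j => //; apply/bigcupP; exists e'.
case/bigcupP => e He Hj ->; exists (rot_edge e); first exact: imset_f.
exact: imset_f.
Qed.

Lemma mem_rot2 n (E : {set {set 'I_n}}) (a b : 'I_n) :
  ([set a; b] \in @rot_edge n @: E)
  = ([set ord_pred a; ord_pred b] \in E).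
Proof.
have -> : [set a; b] = rot_edge [set ord_pred a; ord_pred b].
  by rewrite /rot_edge imsetU !imset_set1 !ord_predK.
exact: mem_imset (@rot_edge_inj n).
Qed.

Lemma val_ord_pred n (a : 'I_n) :
  ord_pred a = (if a == 0%N :> nat then n.-1 else a.-1) :> nat.
Proof.
case: a => [[|a] Ha] /=.
  by rewrite add0n modn_small //; case: n Ha.
by rewrite modnDr modn_small // ltnW.
Qed.

Lemma noncrossing_rot n (E : {set {set 'I_n}}) :
  noncrossing E -> noncrossing (@rot_edge n @: E).
Proof.
move=> /'forall_'forall_'forall_'forall_implyP ncE.
apply/'forall_'forall_'forall_'forall_implyP => a b c d /and3P[ab bc cd].
rewrite !mem_rot2.
have := val_ord_pred a; have := val_ord_pred b.
have := val_ord_pred c; have := val_ord_pred d.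
have [b0 c0 d0] : [/\ (b == 0 :> nat) = false, (c == 0 :> nat) = false
    & (d == 0 :> nat) = false]%N by split; lia.
rewrite b0 c0 d0 => pd pc pb pa.
have dn := ltn_ord d.
have [a0|a0] := eqVneq (nat_of_ord a) 0%N.
  rewrite a0 eqxx in pa.
  rewrite andbC [X in _ && (X \in _)]setUC.
  by apply: ncE; apply/and3P; split; lia.
rewrite (negbTE a0) in pa.
by apply: ncE; apply/and3P; split; lia.
Qed.

Lemma rot_preP n (x : preconf n) : is_NCCB x -> is_NCCB (rot_pre x).
Proof.
case: x => [[E L] m] /and5P[/forall_inP E2 tE ncE dL mE]; apply/and5P; split.
- apply/forall_inP => _ /imsetP[e He ->].
  by rewrite card_imset ?E2 //; exact: ordS_inj.
- apply/trivIsetP => _ _ /imsetP[e He ->] /imsetP[e' He' ->] ne.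
  rewrite (imset_disjoint (@ordS_inj n)) //.
  by apply: (trivIsetP tE) => //; apply: contraNneq ne => ->.
- exact: noncrossing_rot.
- by rewrite cover_rot (imset_disjoint (@ordS_inj n)).
- by case: m mE => //= e He; apply: imset_f.
Qed.

Definition rot_conf n (x : NCCB n) : NCCB n := Sub _ (rot_preP (valP x)).

Lemma rot_conf_inj n : injective (@rot_conf n).
Proof.
move=> x y /(congr1 val) /=.
case: x y => [[[E L] m] Hx] [[[E' L'] m'] Hy] /= [eE eL em].
apply/val_inj => /=; congr (_, _, _).
- exact: imset_inj (@rot_edge_inj n) _ _ eE.
- exact: imset_inj (@ordS_inj n) _ _ eL.
- exact: inj_omap (@rot_edge_inj n) _ _ em.
Qed.

Definition vertex1 n (hn : (0 < n)%N) : 'I_n := Ordinal hn.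

Definition flip_pre n (hn : (0 < n)%N) (x : preconf n) : preconf n :=
  let: (E, L, m) := x in
  let v := vertex1 hn in
  if v \in cover E then x
  else if v \in L then (E, L :\ v, m)
  else (E, v |: L, m).

Lemma flip_preP n (hn : (0 < n)%N) (x : preconf n) :
  is_NCCB x -> is_NCCB (flip_pre hn x).
Proof.
case: x => [[E L] m] H; rewrite /flip_pre; case: ifPn => // vE.
case/and5P: H => E2 tE ncE dL mE.
case: ifPn => vL; apply/and5P; split=> //.
  exact: disjointWl (subD1set _ _) dL.
by rewrite -setI_eq0 setIUl setU_eq0 !setI_eq0 dL disjoints1 vE.
Qed.

Definition flip_conf n (hn : (0 < n)%N) (x : NCCB n) : NCCB n :=
  Sub _ (flip_preP hn (valP x)).

Lemma flip_confK n (hn : (0 < n)%N) : involutive (flip_conf hn).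
Proof.
move=> [[[E L] m] Hx]; apply/val_inj => /=.
case: (ifPn (_ \in cover E)) => [vE|vE] /=; first by rewrite vE.
case: (ifPn (_ \in L)) => vL /=; rewrite (negbTE vE).
  by rewrite !inE eqxx /= setD1K.
by rewrite !inE eqxx /= setU1K.
Qed.

Definition twist_conf n (hn : (0 < n)%N) : NCCB n -> NCCB n :=
  @rot_conf n \o flip_conf hn.

Lemma twist_conf_inj n (hn : (0 < n)%N) : injective (twist_conf hn).
Proof. exact: inj_comp (@rot_conf_inj n) (inv_inj (flip_confK hn)). Qed.

Definition twist n (hn : (0 < n)%N) : {perm NCCB n} := perm (@twist_conf_inj n hn).

(* Main.v *)
Require Import Defs.
From mathcomp Require Import all_boot all_order all_algebra all_fingroup.
From mathcomp Require Import reals complex.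
From mathcomp Require Import cyclic.
From mathcomp Require Import zify ring.

Set Implicit Arguments.
Unset Strict Implicit.
Unset Printing Implicit Defensive.
Import Order.TTheory GRing.Theory Num.Theory.
Local Open Scope ring_scope.

(** Let [g] be the square of the twist. A power of [g] has the same fixed
    points as [g ^+ m] for some [m] with [n = m * k], and there the polynomial
    is evaluated at a primitive [k]-th root of unity, where the q-analogue of
    Lucas' theorem gives ['C(2 * m, m)] ([horner_gauss_binom_mul]). Everything
    reduces to the enumeration [card_twist_fix]: the twist to the power
    [2 * m] fixes exactly ['C(2 * m, m)] configurations. The case [k = 1] counts
    all configurations; as ['C(2 * m, m)] increases strictly with [m], the same
    count shows that [g] has order exactly [n].

    Unroll the circle to the natural numbers, vertex [t] standing for its residue
    modulo [n]. Chords and mark are then [n]-periodic, and the twist shifts them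
    by one. A loop at an unmatched vertex is recorded as a bit that is negated on
    each turn around the circle; with this convention the flip at vertex 1 is
    absorbed and the twist shifts the loop bits as well ([loop_state_twist]).
    Hence being fixed by the twist to the power [2 * m] means that chords, mark
    and loop bits have period [2 * m]. If [k] is odd, this amounts to period
    [r = m] for chords and mark, with loop bits negated by a shift of [m]. If [k]
    is even, a bit would have to be both preserved and negated by a shift of [n],
    so that every vertex is matched, and the period is [r = 2 * m]
    ([twist_fix_sym]).

    Matchings are encoded by words in the steps 1, 0, -1: orient each chord,
    and write 1 at its start, -1 at its end and 0 at unmatched vertices. When
    the orientation is compatible with nesting, the chord starting at [i] ends
    where the height function of the word first returns to its level at [i], so
    word and matching determine each other ([orients_inj] and
    [word_edges_orients]). The orientations of a matching that are compatible
    correspond to the regions that its chords cut out of the disc, and there are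
    two ways to select one:
    - if [r = n], through the mark: reverse exactly the chords that enclose the
      mark, for the linear order of the vertices. The mark is recovered as the
      innermost reversed chord, so pairs (matching, mark) correspond to all
      balanced words ([mark_word_inj] and [mark_word_surj]);
    - if [r] is a proper divisor of [n], a configuration fixed by the twist to the
      power [2 * m] has neither a mark nor a diameter ([admissible_sym]), and the
      region that contains the centre is the invariant one: every chord runs
      along its shorter side ([short_word_orients] and [word_edges_short]).
    In both cases the invariant pairs correspond to the balanced words of period
    [r] ([coding_word_balanced], [coding_word_inj], [coding_word_surj]).

    Finally, merge the word and the loop bits into one bit sequence [a] of period
    [2 * m], in which [a t] is 1 at starts, 0 at ends, and the loop bit at
    unmatched vertices. The word is [a t + a (t + r) - 1], and it is balanced if
    and only if [a] has [m] ones in each period. So the fixed configurations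
    correspond to the subsets with [m] elements of a set with [2 * m]
    elements. *)

(** * Gaussian binomials as polynomials, and their values at roots of unity *)

(** The Gaussian binomial by the q-Pascal rule, a form in which
    non-negativity and evaluation at roots of unity are inductions. *)
Fixpoint gauss_binom (N j : nat) : {poly int} :=
  match N, j with
  | _, 0 => 1
  | 0, _.+1 => 0
  | N'.+1, j'.+1 => gauss_binom N' j' + 'X^j * gauss_binom N' j
  end.

Arguments gauss_binom : simpl never.

Lemma gauss_binom0 N : gauss_binom N 0 = 1.
Proof. by case: N. Qed.

Lemma gauss_binomS N j : gauss_binom N.+1 j.+1
  = gauss_binom N j + 'X^(j.+1) * gauss_binom N j.+1.
Proof. by []. Qed.

Lemma gauss_binom_small N j : (N < j)%N -> gauss_binom N j = 0.
Proof.
elim: N j => [|N IH] [|j] // ltNj.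
by rewrite gauss_binomS !IH ?mulr0 ?addr0 // ltnW.
Qed.

Lemma gauss_binom_nn N : gauss_binom N N = 1.
Proof.
elim: N => // N IH.
by rewrite gauss_binomS IH gauss_binom_small // mulr0 addr0.
Qed.

Lemma gauss_binom_ge0 N j i : 0 <= (gauss_binom N j)`_i.
Proof.
elim: N j i => [|N IH] [|j] i; rewrite ?gauss_binom0 ?coef1 ?coef0 //.
rewrite gauss_binomS coefD coefXnM addr_ge0 //.
by case: ifP.
Qed.

Lemma qfactS k : qfact k.+1 = qfact k * qint k.+1.
Proof. by rewrite /qfact big_ord_recr. Qed.

Lemma qfact0 : qfact 0 = 1.
Proof. by rewrite /qfact big_ord0. Qed.

Lemma qintD i j : qint (i + j) = qint i + 'X^i * qint j.
Proof.
rewrite /qint big_split_ord /= mulr_sumr; congr (_ + _).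
by apply: eq_bigr => k _; rewrite exprD.
Qed.

(** Induction on the Pascal rule, using that the q-integer of [j + i]
    splits as in [qintD]. *)
Lemma gauss_binom_qfact i j :
  gauss_binom (j + i) j * (qfact j * qfact i) = qfact (j + i).
Proof.
move e: (j + i)%N => N; elim: N i j e => [|N IH] [|i] [|j] // e.
- by rewrite qfact0 !mulr1.
- have {e} <- : j.+1 = N.+1 by lia.
  by rewrite qfact0 mulr1 gauss_binom_nn mul1r.
- by have {e} -> : i.+1 = N.+1 by []; rewrite gauss_binom0 qfact0 !mul1r.
have e1 : (j + i.+1)%N = N by lia.
have e2 : (j.+1 + i)%N = N by lia.
have := IH _ _ e1; have := IH _ _ e2.
rewrite gauss_binomS !qfactS; have -> : N.+1 = (j.+1 + i.+1)%N by lia.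
rewrite qintD => h2 h1.
rewrite mulrDr -{1}h1 -h2; ring.
Qed.

Lemma qfact_monic k : qfact k \is monic.
Proof.
rewrite /qfact; apply: monic_prod => i _.
rewrite /qint big_ord_recr /= addrC monicE lead_coefDl ?lead_coefXn //.
rewrite size_polyXn ltnS; apply: (leq_trans (size_sum _ _ _)).
by apply/bigmax_leqP => j _; rewrite size_polyXn.
Qed.

Lemma qbinom_gauss N j : (j <= N)%N -> qbinom N j = gauss_binom N j.
Proof.
move=> jN; rewrite /qbinom jN -{1}(subnKC jN) -gauss_binom_qfact subnKC //.
by apply: Pdiv.IdomainMonic.mulpK; rewrite monicMl ?qfact_monic.
Qed.

Lemma horner_qint (F : fieldType) (z : F) k :
  (map_poly intr (qint k)).[z] * (z - 1) = z ^+ k - 1.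
Proof.
rewrite /qint rmorph_sum horner_sum mulrC [RHS]subrX1; congr (_ * _).
by apply: eq_bigr => i _; rewrite rmorphXn /= map_polyX hornerXn.
Qed.

Lemma horner_qint_prim (F : fieldType) (z : F) P k :
  P.-primitive_root z -> (0 < k < P)%N -> (map_poly intr (qint k)).[z] != 0.
Proof.
move=> prz /andP[k0 kP]; apply/eqP => h; have := horner_qint z k.
rewrite h mul0r => /esym/eqP; rewrite subr_eq0 -(prim_order_dvd prz).
by rewrite gtnNdvd.
Qed.

Lemma horner_map_poly1 (F : fieldType) (z : F) :
  (map_poly intr (1 : {poly int})).[z] = 1.
Proof. by rewrite rmorph1 hornerC. Qed.

Lemma horner_map_poly0 (F : fieldType) (z : F) :
  (map_poly intr (0 : {poly int})).[z] = 0.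
Proof. by rewrite rmorph0 horner0. Qed.

(** The factorial formula has the factor [qint P] on the right, which vanishes
    at a primitive [P]-th root of unity, whereas the q-factorials below [P] do
    not. *)
Lemma horner_gauss_binom_prim (F : fieldType) (z : F) P j :
  P.-primitive_root z -> (map_poly intr (gauss_binom P j)).[z]
    = ((j == 0) || (j == P))%:R.
Proof.
move=> prz; have P0 := prim_order_gt0 prz.
have qf_neq0 k : (k < P)%N -> (map_poly intr (qfact k)).[z] != 0.
  elim: k => [|k IH] kP; first by rewrite qfact0 horner_map_poly1 oner_neq0.
  rewrite qfactS rmorphM hornerM mulf_neq0 ?IH 1?ltnW //.
  exact: horner_qint_prim prz _.
have [->|j0] := eqVneq j 0%N; first by rewrite gauss_binom0 horner_map_poly1.
have [jP|Pj|->] := ltngtP j P; last first.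
- by rewrite gauss_binom_nn horner_map_poly1.
- by rewrite gauss_binom_small // horner_map_poly0.
have := gauss_binom_qfact (P - j) j; rewrite subnKC; last exact: ltnW.
move/(congr1 (fun p => (map_poly intr p).[z])); rewrite !rmorphM !hornerM.
have -> : (map_poly intr (qfact P)).[z] = 0.
  rewrite -(prednK P0) qfactS rmorphM hornerM prednK //.
  suff -> : (map_poly intr (qint P)).[z] = 0 by rewrite mulr0.
  have := horner_qint z P; rewrite prim_expr_order // subrr => /eqP.
  rewrite mulf_eq0 subr_eq0 => /orP[/eqP //|/eqP z1].
  have /eqP P1 : (P == 1)%N.
    by rewrite -dvdn1 (prim_order_dvd prz) expr1 z1.
  by move: jP j0; rewrite P1; case: (j).
move/eqP; rewrite !mulf_eq0 !(negbTE (qf_neq0 _ _)) ?orbF //=; last by lia.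
by move/eqP.
Qed.

(** At a primitive [P]-th root of unity the row [N + P] is the sum of the row [N]
    and of its shift by [P]: both sides satisfy the same Pascal recursion in
    [N], since [z ^+ j] depends on [j] only modulo [P]. *)
Lemma horner_gauss_binomD (F : fieldType) (z : F) P N j :
  P.-primitive_root z -> (map_poly intr (gauss_binom (N + P) j)).[z]
  = (map_poly intr (gauss_binom N j)).[z]
    + (if (P <= j)%N then (map_poly intr (gauss_binom N (j - P))).[z] else 0).
Proof.
move=> prz; have P0 := prim_order_gt0 prz.
elim: N j => [|N IH] j.
  rewrite add0n horner_gauss_binom_prim //.
  case: j => [|j] /=; first by rewrite leqn0 gtn_eqF // horner_map_poly1 addr0.
  rewrite horner_map_poly0 add0r.
  have [jP|Pj|<-] := ltngtP j.+1 P => //.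
    by rewrite gauss_binom_small ?subn_gt0 // horner_map_poly0.
  by rewrite subnn horner_map_poly1.
case: j => [|j].
  by rewrite !gauss_binom0 horner_map_poly1 leqn0 gtn_eqF // addr0.
rewrite addSn !gauss_binomS !rmorphD !rmorphM !hornerD !hornerM !rmorphXn.
rewrite /= !map_polyX !hornerXn !IH.
have [Pj|Pj|Pj] := ltngtP P j.+1.
- have -> : (P <= j)%N by lia.
  have e : z ^+ j.+1 = z ^+ (j - P).+1.
    have -> : j.+1 = ((j - P).+1 + P)%N by lia.
    by rewrite exprD (prim_expr_order prz) mulr1.
  rewrite subSn // gauss_binomS rmorphD rmorphM hornerD hornerM rmorphXn.
  by rewrite /= map_polyX hornerXn e; ring.
- have -> : (P <= j)%N = false by lia.
  by rewrite !addr0.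
have -> : (P <= j)%N = false by lia.
rewrite -Pj subnn !gauss_binom0 horner_map_poly1 (prim_expr_order prz); ring.
Qed.

(** The case of the q-Lucas theorem in which both arguments are multiples of the
    order of the root of unity. *)
Lemma horner_gauss_binom_mul (F : fieldType) (z : F) P a b :
  P.-primitive_root z ->
  (map_poly intr (gauss_binom (a * P) (b * P))).[z] = 'C(a, b)%:R.
Proof.
move=> prz; have P0 := prim_order_gt0 prz; elim: a b => [|a IH] b.
  rewrite mul0n; case: b => [|b]; first by rewrite mul0n horner_map_poly1.
  by rewrite gauss_binom_small ?muln_gt0 // horner_map_poly0.
rewrite mulSnr horner_gauss_binomD // IH; case: b => [|b].
  by rewrite mul0n leqNgt P0 addr0 !bin0.
by rewrite mulSnr leq_addl addnK IH binS natrD.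
Qed.

(** * Words of steps and their height function *)

Lemma periodic_mod (T : Type) r (f : nat -> T) x y :
  (forall t, f (t + r)%N = f t) -> x = y %[mod r] -> f x = f y.
Proof.
move=> per; have perM k z : f (z + k * r)%N = f z.
  by elim: k => [|k IH]; rewrite ?mul0n ?addn0 // mulSnr addnA per.
by move=> e; rewrite (divn_eq x r) (divn_eq y r) e addnC perM addnC perM.
Qed.

Definition height (s : nat -> int) t : int := \sum_(i < t) s i.

Lemma height0 s : height s 0 = 0.
Proof. by rewrite /height big_ord0. Qed.

Lemma heightS s t : height s t.+1 = height s t + s t.
Proof. by rewrite /height big_ord_recr. Qed.

Definition balanced r (s : nat -> int) : Prop :=
  [/\ forall t, -1 <= s t <= 1, forall t, s (t + r)%N = s t & height s r = 0].

(** The arcs of the parenthesis matching of a word: from a step up at [i] to the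
    step down at [j] that first brings the height back to its value before [i]. *)
Definition excursion (s : nat -> int) i j : bool :=
  [&& (i < j)%N, height s j.+1 == height s i &
      all (fun t => height s i < height s t) (iota i.+1 (j - i))].

Lemma excursionP s i j : reflect
  [/\ (i < j)%N, height s j.+1 = height s i &
      forall t, (i < t <= j)%N -> height s i < height s t] (excursion s i j).
Proof.
apply: (iffP and3P) => [[ij /eqP e /allP h]|[ij e h]]; split=> //.
- by move=> t /andP[it tj]; apply: h; rewrite mem_iota; lia.
- exact/eqP.
by apply/allP => t; rewrite mem_iota => ht; apply: h; lia.
Qed.

Lemma height_periodic r s t : balanced r s -> height s (t + r) = height s t.
Proof.
case=> _ sr h0; elim: t => [|t IH]; first by rewrite add0n h0 height0.
by rewrite addSn !heightS IH sr.
Qed.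

Lemma excursion_steps s i j : (forall t, -1 <= s t <= 1) -> excursion s i j ->
  s i = 1 /\ s j = -1.
Proof.
move=> hs /excursionP[ij e h].
have := h i.+1; have := h j; have := hs i; have := hs j.
move: e; rewrite !heightS; lia.
Qed.

Lemma excursion_lt s i j : excursion s i j -> (i < j)%N.
Proof. by case/excursionP. Qed.

(** The height at [i] is attained again one period later. *)
Lemma excursion_ltD r s i j : (0 < r)%N -> balanced r s ->
  excursion s i j -> (j < i + r)%N.
Proof.
move=> r0 bs /excursionP[_ _ h]; rewrite ltnNge; apply/negP => le.
by have := h (i + r)%N; rewrite height_periodic // ltxx; lia.
Qed.

Lemma excursion_inj_close s i j j' : excursion s i j -> excursion s i j' -> j = j'.
Proof.
move=> /excursionP[ij e h] /excursionP[ij' e' h'].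
have [lt|lt|//] := ltngtP j j'.
  by have := h' j.+1; rewrite e ltxx; lia.
by have := h j'.+1; rewrite e' ltxx; lia.
Qed.

Lemma excursion_nested s i j i' j' :
  excursion s i j -> excursion s i' j' -> (i < i' <= j)%N -> (j' < j)%N.
Proof.
move=> /excursionP[ij e h] /excursionP[ij' e' h'] lt.
have := h i' lt; have [//|lt'|eq] := ltngtP j' j.
  by have := h' j.+1; rewrite e; lia.
by move: e; rewrite -eq e' => ->; rewrite ltxx.
Qed.

Lemma excursion_inj_open s i j i' : excursion s i j -> excursion s i' j -> i = i'.
Proof.
move=> a a'; have ij := excursion_lt a; have ij' := excursion_lt a'.
have [lt|lt|//] := ltngtP i i'.
  by have := excursion_nested a a'; lia.
by have := excursion_nested a' a; lia.
Qed.

Lemma height_periodicM r s k : (forall t, s (t + r)%N = s t) ->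
  height s (k * r) = height s r *+ k.
Proof.
move=> per; elim: k => [|k IH]; first by rewrite mul0n height0.
have hD t : height s (k * r + t) = height s (k * r) + height s t.
  elim: t => [|t IHt]; first by rewrite height0 addn0 addr0.
  rewrite addnS !heightS IHt addrA; congr (_ + _).
  by apply: (periodic_mod per); rewrite modnMDl.
by rewrite mulSnr hD IH mulrSr.
Qed.

Lemma excursion_shift r s i j : balanced r s ->
  excursion s (i + r) (j + r) = excursion s i j.
Proof.
move=> bs; have hp t := height_periodic t bs.
apply/excursionP/excursionP => [[ij e h]|[ij e h]]; split.
- by rewrite ltn_add2r in ij.
- by move: e; rewrite -addSn !hp.
- by move=> t ht; rewrite -hp -(hp t); apply: h; lia.
- by rewrite ltn_add2r.
- by rewrite -addSn !hp.
move=> t ht; have e' : t = (t - r + r)%N by lia.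
by rewrite e' !hp; apply: h; lia.
Qed.

(** The end is found at the first return of the height to its value at [i]; by
    periodicity there is a return, and steps of size at most one cannot jump
    over it. *)
Lemma excursion_open_ex r s i : (0 < r)%N -> balanced r s -> s i = 1 ->
  exists j, excursion s i j.
Proof.
move=> r0 bs si; have [hs _ _] := bs.
pose P t := (i < t)%N && (height s t == height s i).
have exP : exists t, P t.
  by exists (i + r)%N; rewrite /P height_periodic // eqxx; lia.
case: (ex_minnP exP) => t /andP[it /eqP e] min.
have pos u : (i < u < t)%N -> height s i < height s u.
  elim: u => // u IH /andP[iu ut].
  have [<-|ne] := eqVneq i u; first by rewrite heightS si; lia.
  have := IH; have := hs u; have := min u.+1; rewrite /P heightS.
  by lia.
have it1 : t != i.+1 by apply: contra_eqN e => /eqP ->; rewrite heightS si; lia.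
exists t.-1; apply/excursionP; split; try lia.
  by rewrite -e; congr height; lia.
by move=> u hu; apply: pos; lia.
Qed.

(** Mirror image of [excursion_open_ex]. A full period is needed to the left of
    [j], because positions are natural numbers. *)
Lemma excursion_close_ex r s j : (0 < r <= j)%N -> balanced r s -> s j = -1 ->
  exists i, excursion s i j.
Proof.
move=> /andP[r0 rj] bs sj; have [hs _ _] := bs.
pose P i := (i < j)%N && (height s i == height s j.+1).
have exP : exists i, P i.
  have e : height s (j.+1 - r) = height s j.+1.
    by rewrite -(height_periodic (j.+1 - r) bs); congr height; lia.
  exists (j.+1 - r)%N; rewrite /P e eqxx andbT ltn_neqAle; apply/andP; split.
    by apply: contra_eqN e => /eqP ->; rewrite heightS sj; lia.
  lia.
have ubP i : P i -> (i <= j)%N by case/andP => /ltnW.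
case: (ex_maxnP exP ubP) => i /andP[ij /eqP e] max.
have pos k : (k < j - i)%N -> height s i < height s (j - k).
  elim: k => [|k IH] hk.
    by rewrite subn0 e heightS sj; lia.
  have := IH; have := hs (j - k.+1)%N; have := max (j - k.+1)%N.
  have -> : (j - k = (j - k.+1).+1)%N by lia.
  by rewrite /P -e heightS; lia.
exists i; apply/excursionP; split=> // t ht.
by have := pos (j - t)%N; rewrite subKn; lia.
Qed.

(** The properties of oriented chords from which the word alone determines them. *)
Record laminar (s : nat -> int) (D : nat -> nat -> Prop) : Prop := Laminar {
  laminar_arc : forall i j, D i j -> [/\ (i < j)%N, s i = 1 & s j = -1];
  laminar_open : forall i j c, D i j -> (i < c < j)%N -> s c = 1 ->
    exists2 d, (d < j)%N & D c d;
  laminar_close : forall i j c, D i j -> (i < c < j)%N -> s c = -1 ->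
    exists2 b, (i < b)%N & D b c;
  laminar_inj_close : forall i j j', D i j -> D i j' -> j = j' }.

(** Between two positions with no arc leaving the segment, the height comes back
    to its initial value without having gone below it: the arcs which start in
    the segment split it into shorter segments of the same kind. *)
Lemma laminar_height s D u j : (forall t, -1 <= s t <= 1) -> laminar s D ->
  (u <= j)%N ->
  (forall c, (u <= c < j)%N -> s c = 1 -> exists2 d, (d < j)%N & D c d) ->
  (forall c, (u <= c < j)%N -> s c = -1 -> exists2 b, (u <= b)%N & D b c) ->
  height s j = height s u /\
  forall t, (u <= t <= j)%N -> height s u <= height s t.
Proof.
move=> hs lam.
have [k] := ubnP (j - u)%N; elim: k u j => // k IH u j.
move=> ju uj opn cls.
have [<-|ltuj] : u = j \/ (u < j)%N by lia.
  by split=> // t ht; have -> : t = u by lia.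
have [su|[su|su]] : s u = 1 \/ s u = 0 \/ s u = -1 by have := hs u; lia.
- have [d dj Dd] := opn u ltac:(lia) su; have [ud _ sd] := laminar_arc lam Dd.
  have [e1 h1] : height s d = height s u.+1 /\
      forall t, (u.+1 <= t <= d)%N -> height s u.+1 <= height s t.
    apply: IH; try lia.
    - by move=> c hc sc; apply: (laminar_open lam Dd).
    by move=> c hc sc; apply: (laminar_close lam Dd).
  have [e2 h2] : height s j = height s d.+1 /\
      forall t, (d.+1 <= t <= j)%N -> height s d.+1 <= height s t.
    apply: IH; try lia.
    - by move=> c hc sc; apply: opn => //; lia.
    move=> c hc sc; have [b ub Db] := cls c ltac:(lia) sc; exists b => //.
    have [_ sb _] := laminar_arc lam Db.
    have bu : b <> u by move=> e; have := laminar_inj_close lam Db; rewrite e;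
      move=> /(_ _ Dd); lia.
    have bd : b <> d by move=> e; rewrite e sd in sb.
    have [//|bd'] := ltnP d b; case: (laminar_open lam Dd _ sb); first lia.
    by move=> d' d'd /(laminar_inj_close lam Db); lia.
  move: e1 e2 h1 h2; rewrite !heightS su sd => e1 e2 h1 h2; split; first lia.
  move=> t ht; have [<-|[hu|hd]] : u = t \/ (u < t <= d)%N \/ (d < t <= j)%N.
  - lia.
  - by [].
  - by have := h1 t hu; lia.
  by have := h2 t hd; lia.
- have [e1 h1] : height s j = height s u.+1 /\
      forall t, (u.+1 <= t <= j)%N -> height s u.+1 <= height s t.
    apply: IH; try lia.
    - by move=> c hc sc; apply: opn => //; lia.
    move=> c hc sc; have [b ub Db] := cls c ltac:(lia) sc; exists b => //.
    have [_ sb _] := laminar_arc lam Db; rewrite ltn_neqAle ub andbT.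
    by apply: contra_eqN sb => /eqP <-; rewrite su.
  move: e1 h1; rewrite !heightS su addr0 => e1 h1; split=> // t ht.
  have [<- //|hu] : u = t \/ (u < t <= j)%N by lia.
  exact: h1.
have [b ub Db] := cls u ltac:(lia) su; have [bu _ _] := laminar_arc lam Db.
lia.
Qed.

(** The word alone determines a laminar system, as the parenthesis matching of
    its steps. *)
Lemma laminar_arcE s D i j : (forall t, -1 <= s t <= 1) -> laminar s D ->
  D i j -> excursion s i j.
Proof.
move=> hs lam Dij; have [ij si sj] := laminar_arc lam Dij.
have [e h] : height s j = height s i.+1 /\
    forall t, (i.+1 <= t <= j)%N -> height s i.+1 <= height s t.
  apply: (laminar_height hs lam) => //.
  - by move=> c hc sc; apply: (laminar_open lam Dij).
  by move=> c hc sc; apply: (laminar_close lam Dij).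
apply/excursionP; split=> //; first by rewrite heightS e heightS si sj; lia.
by move=> t /h; rewrite heightS si; lia.
Qed.

(** * Chords, and the orientations that turn a matching into a word *)

Lemma mod_window n a x y : (a <= x < a + n)%N -> (a <= y < a + n)%N ->
  x = y %[mod n] -> x = y.
Proof.
wlog le : x y / (x <= y)%N => [th hx hy e|hx hy /esym/eqP].
  by case/orP: (leq_total x y) => le; [|apply/esym]; apply: th.
rewrite eqn_mod_dvd // => /dvdnP[[|q] e]; first by lia.
by move: e; rewrite mulSn; lia.
Qed.

(** The representative of [b] modulo [N.+1] in the window of length [N.+1] that
    starts at [a]. Adding [N * a] amounts to subtracting [a] modulo [N.+1]. *)
Definition lift_from N (a b : nat) : nat := (a + (b + N * a) %% N.+1)%N.

Lemma lift_from_mod N a b : lift_from N a b = b %[mod N.+1].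
Proof.
rewrite /lift_from modnDmr; have -> : (a + (b + N * a) = a * N.+1 + b)%N by lia.
by rewrite modnMDl.
Qed.

Lemma lift_from_bound N a b : (a <= lift_from N a b < a + N.+1)%N.
Proof. by rewrite /lift_from leq_addr ltn_add2l ltn_pmod. Qed.

Lemma lift_from_unique N a b c : (a <= c < a + N.+1)%N ->
  c = b %[mod N.+1] -> lift_from N a b = c.
Proof.
move=> hc e; apply: (@mod_window N.+1 a) => //; first exact: lift_from_bound.
by rewrite lift_from_mod.
Qed.

Lemma lift_from_eql N a b b' : b = b' %[mod N.+1] ->
  lift_from N a b = lift_from N a b'.
Proof.
move=> e; apply: lift_from_unique; first exact: lift_from_bound.
by rewrite lift_from_mod.
Qed.

Lemma lift_from_id N a b : (a <= b < a + N.+1)%N -> lift_from N a b = b.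
Proof. by move=> h; apply: lift_from_unique. Qed.

Lemma lift_from_wrap N a b : (a < b < a + N.+1)%N ->
  lift_from N b a = (a + N.+1)%N.
Proof. by move=> h; apply: lift_from_unique; rewrite ?modnDr //; lia. Qed.

Lemma inZp_eqP N a b :
  reflect (a = b %[mod N.+1]) (inZp a == inZp b :> 'I_N.+1).
Proof. by rewrite -val_eqE; apply: eqP. Qed.

Lemma inZp_mod N a b : a = b %[mod N.+1] -> inZp a = inZp b :> 'I_N.+1.
Proof. by move/inZp_eqP/eqP. Qed.

Lemma set2_eqE (T : finType) (a b c d : T) : [set a; b] = [set c; d] ->
  (a = c /\ b = d) \/ (a = d /\ b = c).
Proof.
move=> e; have : [/\ a \in [set c; d], b \in [set c; d],
    c \in [set a; b] & d \in [set a; b]] 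
  by split; rewrite -?e ?set21 ?set22 // e ?set21 ?set22.
rewrite !inE => -[] /orP[]/eqP-> /orP[]/eqP-> /orP[]/eqP e1 /orP[]/eqP e2; auto.
Qed.

Section Matching.
Context {N : nat}.
Implicit Types (E : {set {set 'I_N.+1}}) (s : nat -> int).

(** Vertices are unrolled: natural numbers are read modulo [N.+1]. *)
Definition chord E (a b : nat) : bool := [set inZp a; inZp b] \in E.

Definition matched E (a : nat) : bool := inZp a \in cover E.

Definition matching E : bool :=
  [&& [forall e in E, #|e| == 2], trivIset E & noncrossing E].

Lemma chordC E a b : chord E a b = chord E b a.
Proof. by rewrite /chord setUC. Qed.

Lemma chord_mod E a a' b b' : a = a' %[mod N.+1] -> b = b' %[mod N.+1] ->
  chord E a b = chord E a' b'.
Proof. by move=> /inZp_mod ea /inZp_mod eb; rewrite /chord ea eb. Qed.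

Lemma chord_lift E a b c : chord E a (lift_from N c b) = chord E a b.
Proof. by apply: chord_mod => //; rewrite lift_from_mod. Qed.

Lemma chord_matched E a b : chord E a b -> matched E a.
Proof. by move=> h; apply/bigcupP; exists [set inZp a; inZp b]; rewrite ?set21. Qed.

Lemma matched_mod E a b : a = b %[mod N.+1] -> matched E a = matched E b.
Proof. by move=> /inZp_mod e; rewrite /matched e. Qed.

Lemma edgeE E e : matching E -> e \in E ->
  exists a b, [/\ (a < b < N.+1)%N, e = [set inZp a; inZp b] & chord E a b].
Proof.
case/and3P => /forall_inP h2 _ _ eE; have /cards2P[x [y [xy def]]] := h2 e eE.
have [lt|lt|e'] := ltngtP x y.
- exists x, y; rewrite /chord !valZpK -def eE; split=> //.
  by rewrite lt ltn_ord.
- exists y, x; rewrite /chord !valZpK setUC -def eE; split=> //.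
  by rewrite lt ltn_ord.
by move/val_inj: e' xy => ->; rewrite eqxx.
Qed.

Lemma chord_neq E a b : matching E -> chord E a b -> a <> b %[mod N.+1].
Proof.
case/and3P => /forall_inP h2 _ _ /h2; rewrite cards2 => ab /inZp_eqP e.
by rewrite e in ab.
Qed.

Lemma chord_inj E a b c : matching E -> chord E a b -> chord E a c ->
  b = c %[mod N.+1].
Proof.
move=> mE ab ac; have [nab nac] := (chord_neq mE ab, chord_neq mE ac).
have /and3P[_ /trivIsetP tE _] := mE.
have [e|ne] := eqVneq [set inZp a; inZp b] [set inZp a; inZp c : 'I_N.+1].
  case: (set2_eqE e) => -[e1 e2]; first exact/inZp_eqP/eqP.
  by case: nac; apply/inZp_eqP/eqP.
have := tE _ _ ab ac ne; rewrite -setI_eq0 => /eqP/setP/(_ (inZp a)).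
by rewrite !inE eqxx.
Qed.

Lemma matched_lift E a c : matching E -> matched E a ->
  exists2 b, (c <= b < c + N.+1)%N & chord E a b.
Proof.
move=> mE /bigcupP[e eE ae]; have [x [y [xy def xyE]]] := edgeE mE eE.
have [b ab] : exists b, chord E a b.
  move: ae; rewrite def !inE => /orP[]/inZp_eqP eq; [exists y|exists x].
    by rewrite (chord_mod _ eq (erefl _)).
  by rewrite (chord_mod _ eq (erefl _)) chordC.
by exists (lift_from N c b); rewrite ?chord_lift // lift_from_bound.
Qed.

Lemma matched_shift E r t : matching E ->
  (forall a b, chord E (a + r) (b + r) = chord E a b) ->
  matched E (t + r) = matched E t.
Proof.
move=> mE inv; apply/idP/idP => /(matched_lift r mE)[b bl].
  have -> : b = (b - r + r)%N by lia.
  by rewrite inv; apply: chord_matched.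
by rewrite -inv; apply: chord_matched.
Qed.

Lemma noncrossingP E : noncrossing E -> forall a b c d,
  (a < b)%N -> (b < c)%N -> (c < d)%N -> (d < N.+1)%N ->
  chord E a c -> chord E b d -> False.
Proof.
move=> /'forall_'forall_'forall_'forall_implyP nc a b c d ab bc cd dn ac bd.
have := nc (inZp a) (inZp b) (inZp c) (inZp d).
rewrite /= !modn_small; try lia.
by rewrite ab bc cd -/(chord E a c) -/(chord E b d) ac bd => /(_ isT).
Qed.

(** The condition on the chords of the linear order [0, ..., N], stated
    cyclically: the crossing pattern survives any choice of the cut, and
    each of the four positions of the cut among the end points gives an
    instance of [noncrossingP]. *)
Lemma chord_nocross E i c j d : matching E ->
  (i < c)%N -> (c < j)%N -> (j < d)%N -> (d < i + N.+1)%N ->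
  chord E i j -> chord E c d -> False.
Proof.
case/and3P => _ _ /noncrossingP nc.
have sub (x y : nat) : (x * N.+1 <= y)%N -> y = (y - x * N.+1)%N %[mod N.+1].
  by move=> le; rewrite -{1}(subnK le) addnC modnMDl.
wlog iN : i c j d / (i < N.+1)%N => [th ic cj jd di ij cd|].
  (* Whole turns are subtracted, so that the cut falls after [i]. *)
  set q := (i %/ N.+1)%N; have e := divn_eq i N.+1.
  apply: (th (i - q * N.+1) (c - q * N.+1) (j - q * N.+1) (d - q * N.+1))%N.
  - by rewrite {1}e addKn ltn_pmod.
  1-4: by move: e; rewrite -/q; lia.
  - by rewrite -(chord_mod _ (sub _ _ _) (sub _ _ _)) //; move: e; rewrite -/q; lia.
  by rewrite -(chord_mod _ (sub _ _ _) (sub _ _ _)) //; move: e; rewrite -/q; lia.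
have {}sub y : (N.+1 <= y)%N -> y = (y - N.+1)%N %[mod N.+1].
  by have := sub 1%N y; rewrite mul1n.
move=> ic cj jd di ij cd.
have [dN|Nd] := ltnP d N.+1; first exact: (nc i c j d).
rewrite (chord_mod _ (erefl _) (sub d Nd)) in cd.
have [jN|Nj] := ltnP j N.+1.
  by rewrite chordC in cd; apply: (nc (d - N.+1) i c j)%N => //; lia.
rewrite (chord_mod _ (erefl _) (sub j Nj)) in ij.
have [cN|Nc] := ltnP c N.+1.
  by rewrite chordC in ij; rewrite chordC in cd;
    apply: (nc (j - N.+1) (d - N.+1) i c)%N => //; lia.
rewrite (chord_mod _ (sub c Nc) (erefl _)) in cd; rewrite chordC in ij.
by apply: (nc (c - N.+1) (j - N.+1) (d - N.+1) i)%N => //; rewrite 1?chordC //; lia.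
Qed.

Lemma chord_ext E E' : matching E -> matching E' ->
  (forall a b, chord E a b -> chord E' a b) ->
  (forall a b, chord E' a b -> chord E a b) -> E = E'.
Proof.
move=> mE mE' h h'; apply/setP => e; apply/idP/idP => he.
  by have [a [b [_ -> /h]]] := edgeE mE he.
by have [a [b [_ -> /h']]] := edgeE mE' he.
Qed.

(** The word [s] orients the chords of [E] (1 at starts, -1 at ends) in a way
    compatible with nesting: a chord that lies under an oriented chord, on the
    side swept from its start to its end, runs in the same direction. *)
Record orients E s : Prop := Orients {
  orients_step : forall t, -1 <= s t <= 1;
  orients_periodic : forall t, s (t + N.+1)%N = s t;
  orients_free : forall t, (s t == 0) = ~~ matched E t;
  orients_opp : forall a b, chord E a b -> s b = - s a;
  orients_inside : forall i j c d, (i < c)%N -> (c < d)%N -> (d < j)%N ->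
    (j < i + N.+1)%N -> chord E i j -> s i = 1 -> chord E c d -> s c = 1 }.

Definition oriented_chord E s i j : Prop :=
  [/\ (i < j < i + N.+1)%N, chord E i j & s i = 1].

(** A chord starting strictly under [i, j] stays there, since it neither shares an
    end point with this chord nor crosses it. *)
Lemma inner_partner E i j c : matching E -> (i < c < j)%N ->
  (j < i + N.+1)%N -> chord E i j -> matched E c ->
  exists2 d, (i < d < j)%N & chord E c d.
Proof.
move=> mE icj jn ij mc; have [d id cd] := matched_lift i mE mc.
exists d => //; have di : d <> i.
  move=> e; rewrite e chordC in cd; have := chord_inj mE ij cd.
  by move/(@mod_window N.+1 i j c); lia.
have dj : d <> j.
  move=> e; rewrite e chordC in cd; rewrite chordC in ij.
  have := chord_inj mE ij cd.
  by move/(@mod_window N.+1 i i c); lia.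
have [//|jd] : (d < j)%N \/ (j < d)%N by lia.
  by lia.
by case: (chord_nocross mE _ _ jd _ ij cd); lia.
Qed.

Lemma orients_laminar E s : matching E -> orients E s ->
  laminar s (oriented_chord E s).
Proof.
move=> mE oE; split.
- move=> i j [ij cij si]; split=> //; first by lia.
  by rewrite (orients_opp oE cij) si.
- move=> i j c [ij cij si] icj sc.
  have mc : matched E c by rewrite -[matched _ _]negbK -(orients_free oE) sc.
  have [d idj cd] := inner_partner mE icj ltac:(lia) cij mc.
  exists d; first by lia.
  split=> //; have [dc|cd'|e] := ltngtP d c; first 1 last.
  - by lia.
  - by case: (chord_neq mE cd); rewrite e.
  rewrite chordC in cd; have sd := orients_inside oE _ dc _ _ cij si cd.
  by have := orients_opp oE cd; rewrite sd ?sc; lia.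
- move=> i j c [ij cij si] icj sc.
  have mc : matched E c by rewrite -[matched _ _]negbK -(orients_free oE) sc.
  have [d idj cd] := inner_partner mE icj ltac:(lia) cij mc.
  exists d; first by lia.
  have sd : s d = 1 by rewrite (orients_opp oE cd) sc.
  split; rewrite 1?chordC //; have [dc|cd'|e] := ltngtP d c.
  - by lia.
  - have := orients_inside oE _ cd' _ _ cij si cd; rewrite sc.
    by lia.
  by case: (chord_neq mE cd); rewrite e.
move=> i j j' [ij cij _] [ij' cij' _].
  by apply: (@mod_window N.+1 i); rewrite ?(chord_inj mE cij cij') //; lia.
Qed.

Lemma orients_arc E s i j : matching E -> orients E s ->
  (i < j < i + N.+1)%N -> chord E i j -> s i = 1 -> excursion s i j.
Proof.
move=> mE oE ij cij si.
by apply: (laminar_arcE (orients_step oE) (orients_laminar mE oE)).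
Qed.

Lemma excursion_orients E s i j : matching E -> orients E s -> excursion s i j ->
  (i < j < i + N.+1)%N /\ chord E i j.
Proof.
move=> mE oE a; have [si _] := excursion_steps (orients_step oE) a.
have mi : matched E i by rewrite -[matched _ _]negbK -(orients_free oE) si.
have [d id cid] := matched_lift i mE mi.
have lt : (i < d < i + N.+1)%N.
  have [e|//] : i = d \/ (i < d < i + N.+1)%N by lia.
  by case: (chord_neq mE cid); rewrite e.
by have -> : j = d by apply: excursion_inj_close a _; apply: orients_arc oE lt cid si.
Qed.

(** Each chord contributes its two opposite steps. *)
Lemma orients_height E s : matching E -> orients E s -> height s N.+1 = 0.
Proof.
move=> mE oE; rewrite /height (bigID (fun i : 'I__ => i \in cover E)) /=.
rewrite [X in _ + X]big1 => [|i iE]; last first.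
  by apply/eqP; rewrite (orients_free oE) /matched valZpK.
rewrite addr0 big_trivIset; last by case/and3P: mE.
apply: big1 => e eE; have [a [b [ab -> cab]]] := edgeE mE eE.
rewrite big_setU1 ?big_set1 /=; last first.
  by rewrite inE; apply/inZp_eqP; apply: chord_neq cab.
by rewrite !modn_small ?(orients_opp oE cab); lia.
Qed.

Lemma orients_balanced E s : matching E -> orients E s -> balanced N.+1 s.
Proof.
move=> mE oE; split; [exact: orients_step oE|exact: orients_periodic oE|].
exact: orients_height oE.
Qed.

(** In both matchings the chords are the excursions of [s]. *)
Lemma orients_inj E E' s : matching E -> matching E' ->
  orients E s -> orients E' s -> E = E'.
Proof.
have sub F F' a b : matching F -> matching F' -> orients F s -> orients F' s ->
    chord F a b -> chord F' a b.
  move=> mF mF' oF oF'.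
  wlog sa : a b / s a = 1 => [th ab|ab].
    have [|[sa|sa]] : s a = 0 \/ s a = 1 \/ s a = -1.
    - by have := orients_step oF a; lia.
    - by move/eqP; rewrite (orients_free oF) (chord_matched ab).
    - exact: th.
    by rewrite chordC; apply: th; rewrite 1?chordC // (orients_opp oF ab) sa.
  rewrite -(chord_lift F a b a) in ab; rewrite -(chord_lift F' a b a).
  have lt : (a < lift_from N a b < a + N.+1)%N.
    have lb := lift_from_bound N a b.
    have [e|//] : a = lift_from N a b \/ (a < lift_from N a b < a + N.+1)%N.
      by lia.
    by case: (chord_neq mF ab); rewrite -e.
  by have [] := excursion_orients mF' oF' (orients_arc mF oF lt ab sa).
move=> mE mE' oE oE'; apply: chord_ext => // a b.
  exact: sub mE mE' oE oE'.
exact: sub mE' mE oE' oE.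
Qed.

End Matching.

(** * The matching drawn by a balanced word *)

Lemma excursion_shiftM r s k i j : balanced r s ->
  excursion s (i + k * r) (j + k * r) = excursion s i j.
Proof.
move=> bs; elim: k => [|k IH]; first by rewrite mul0n !addn0.
by rewrite mulSnr !addnA (excursion_shift _ _ bs).
Qed.

Section Realization.
Context {N : nat}.
Implicit Types (E : {set {set 'I_N.+1}}) (s : nat -> int).

Definition linked s a b : bool :=
  excursion s a (lift_from N a b) || excursion s b (lift_from N b a).

Definition word_edges s : {set {set 'I_N.+1}} :=
  [set e | [exists a : 'I_N.+1, exists b : 'I_N.+1,
     (e == [set a; b]) && linked s a b]].

Lemma linkedC s a b : linked s a b = linked s b a.
Proof. by rewrite /linked orbC. Qed.

Lemma lift_fromD a b : lift_from N (a + N.+1) b = (lift_from N a b + N.+1)%N.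
Proof.
have := lift_from_bound N a b => h; apply: lift_from_unique; first by lia.
by rewrite modnDr lift_from_mod.
Qed.

Lemma linked_shift s a b : balanced N.+1 s -> linked s (a + N.+1) b = linked s a b.
Proof.
move=> bs; rewrite /linked lift_fromD (excursion_shift _ _ bs).
by rewrite (@lift_from_eql N b (a + N.+1) a) // modnDr.
Qed.

Lemma linked_mod s a a' b b' : balanced N.+1 s -> a = a' %[mod N.+1] ->
  b = b' %[mod N.+1] -> linked s a b = linked s a' b'.
Proof.
move=> bs; have red x y : linked s x y = linked s (x %% N.+1) y.
  rewrite {1}(divn_eq x N.+1) addnC; elim: (x %/ N.+1)%N => [|k IH].
    by rewrite mul0n addn0.
  by rewrite mulSnr addnA linked_shift.
move=> ea eb; rewrite red ea -red linkedC red eb -red linkedC //.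
Qed.

Lemma linked_excursion s a b : balanced N.+1 s -> excursion s a b -> linked s a b.
Proof.
move=> bs h; have lt := excursion_lt h; have ub := excursion_ltD (ltn0Sn N) bs h.
by rewrite /linked lift_from_id ?h //; lia.
Qed.

Lemma linked_window s a b : (a < b < a + N.+1)%N ->
  linked s a b = excursion s a b || excursion s b (a + N.+1).
Proof. by move=> h; rewrite /linked (lift_from_wrap h) lift_from_id //; lia. Qed.

Lemma chord_word_edges s a b : balanced N.+1 s ->
  chord (word_edges s) a b = linked s a b.
Proof.
move=> bs; rewrite /chord inE; apply/existsP/idP => [[x /existsP[y]]|h].
  case/andP => /eqP e; have := linked_mod (a := a) (b := b) bs.
  case: (set2_eqE e) => -[/(congr1 val) /= ea /(congr1 val) /= eb] lm.
    by rewrite (lm x y) ?ea ?eb // modn_small.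
  by rewrite (lm y x) ?ea ?eb 1?linkedC // modn_small.
exists (inZp a); apply/existsP; exists (inZp b); rewrite eqxx /=.
by rewrite (@linked_mod _ _ a _ b bs) //= modn_mod.
Qed.

(** After a shift by a multiple of the period, both excursions have the same
    end. *)
Lemma excursion_end_inj s a b j j' : balanced N.+1 s ->
  excursion s a j -> excursion s b j' -> j = j' %[mod N.+1] -> a = b %[mod N.+1].
Proof.
move=> bs; wlog le : a b j j' / (j <= j')%N => [th h h' e|h h' /esym/eqP].
  by case/orP: (leq_total j j') => le; [|apply/esym]; apply: th le _ _ _.
rewrite eqn_mod_dvd // => /dvdnP[k e].
move: h; rewrite -(excursion_shiftM k _ _ bs).
have -> : (j + k * N.+1)%N = j' by lia.
by move=> /excursion_inj_open /(_ h') <-; rewrite addnC modnMDl.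
Qed.

Lemma linked_inj s a b c : balanced N.+1 s -> linked s a b -> linked s a c ->
  b = c %[mod N.+1].
Proof.
move=> bs; have [hs per _] := bs.
have smod x y := periodic_mod (x := x) (y := y) per.
case/orP=> h /orP[] h'.
- have := excursion_inj_close h h' => e.
  by rewrite -(lift_from_mod N a b) e lift_from_mod.
- have [s1 _] := excursion_steps hs h; have [_ s2] := excursion_steps hs h'.
  by move: s2; rewrite (smod _ _ (lift_from_mod N c a)) s1.
- have [_ s1] := excursion_steps hs h; have [s2 _] := excursion_steps hs h'.
  by move: s1; rewrite (smod _ _ (lift_from_mod N b a)) s2.
by apply: (excursion_end_inj bs h h'); rewrite !lift_from_mod.
Qed.

(** Excursions that share an end point coincide up to periods, and excursions are
    nested or disjoint; a crossing of two chords of the circle would lift to two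
    interleaved excursions. *)
Lemma word_edges_matching s : balanced N.+1 s -> matching (word_edges s).
Proof.
move=> bs; have edgeP e : e \in word_edges s ->
    exists a b : 'I_N.+1, e = [set a; b] /\ linked s a b.
  by rewrite inE => /existsP[a /existsP[b /andP[/eqP ->]]]; exists a, b.
have neq a b : linked s a b -> a <> b.
  move=> h e; move: h; rewrite e /linked orbb lift_from_id; last by lia.
  by move/excursion_lt; rewrite ltnn.
apply/and3P; split.
- apply/forall_inP => e /edgeP[a [b [-> h]]]; rewrite cards2.
  by case: (a =P b) => // ab; case: (neq _ _ h); rewrite ab.
- have inj (a b c : 'I_N.+1) : linked s a b -> linked s a c -> b = c.
    move=> h /(linked_inj bs h); rewrite !modn_small //; exact: val_inj.
  apply/trivIsetP => _ _ /edgeP[a [b [-> h]]] /edgeP[c [d [-> h']]] ne.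
  have h2 := h; have h2' := h'; rewrite linkedC in h2; rewrite linkedC in h2'.
  rewrite -setI_eq0; apply: contraNT ne => /set0Pn[x]; rewrite !inE.
  case/andP => /orP[]/eqP-> /orP[]/eqP e; subst; apply/eqP.
  + by rewrite (inj _ _ _ h h').
  + by rewrite (inj _ _ _ h h2') setUC.
  + by rewrite (inj _ _ _ h2 h') setUC.
  by rewrite (inj _ _ _ h2 h2').
apply/'forall_'forall_'forall_'forall_implyP => a b c d /and3P[ab bc cd].
have dN := ltn_ord d.
have chE (x y : 'I_N.+1) : ([set x; y] \in word_edges s) = linked s x y.
  by rewrite -chord_word_edges // /chord !valZpK.
rewrite !chE !linked_window; try lia.
apply/negP => /andP[/orP[] h /orP[] h'].
- by have := excursion_nested h h'; lia.
- rewrite -(excursion_shift _ _ bs) in h.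
  by have := excursion_nested h' h; lia.
- by have := excursion_nested h' h; lia.
by have := excursion_nested h h'; lia.
Qed.

Lemma word_edges_orients s : balanced N.+1 s -> orients (word_edges s) s.
Proof.
move=> bs; have [hs per _] := bs; have mE := word_edges_matching bs.
have smod x y := periodic_mod (x := x) (y := y) per.
have opp a b : linked s a b -> s b = - s a /\ s a != 0.
  case/orP => /(excursion_steps hs); rewrite (smod _ _ (lift_from_mod N _ _)).
    by case=> -> ->.
  by case=> -> ->.
split=> //.
- move=> t; apply/idP/idP => [/eqP st|].
    apply/negP => /(matched_lift 0 mE)[b _]; rewrite chord_word_edges //.
    by move/opp; rewrite st eqxx => -[].
  apply: contraNT => st.
  have [s1|s1] : s t = 1 \/ s t = -1 by have := hs t; lia.
    have [j h] := excursion_open_ex (ltn0Sn N) bs s1.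
    by apply: (@chord_matched _ _ _ j); rewrite chord_word_edges ?linked_excursion.
  rewrite -per in s1; have [|i h] := excursion_close_ex _ bs s1; first by lia.
  apply: (@chord_matched _ _ _ i); rewrite chord_word_edges //.
  rewrite linkedC; have := linked_excursion bs h.
  by rewrite linkedC linked_shift // linkedC.
- by move=> a b; rewrite chord_word_edges // => /opp[].
move=> i j c d ic cd dj jn; rewrite !chord_word_edges // => ij si.
rewrite linked_window; last by lia.
move: ij; rewrite linked_window; last by lia.
case/orP => [h|/(excursion_steps hs)]; last by rewrite per si => -[].
case/orP => [/(excursion_steps hs)[] //|h'].
by have := excursion_nested h h'; lia.
Qed.

End Realization.

(** * Two orientations: away from a mark, and along the shorter side *)

Section Orientations.
Context {N : nat}.
Implicit Types (E : {set {set 'I_N.+1}}) (s : nat -> int).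
Implicit Types (m : option {set 'I_N.+1}).

(** Each chord is oriented along the shorter of its two sides; a diameter, which
    has none, is given the value -1 at both ends. *)
Definition short_word E (t : nat) : int :=
  if [exists d : 'I_N.+1, chord E t (t + d) && (d.*2 < N.+1)%N] then 1
  else if matched E t then -1 else 0.

Definition diameter_free E := forall a d, chord E a (a + d) -> d.*2 <> N.+1.

Lemma short_word_chord E a d : matching E -> chord E a (a + d) ->
  (0 < d < N.+1)%N -> short_word E a = if (d.*2 < N.+1)%N then 1 else -1.
Proof.
move=> mE ad dN; rewrite /short_word (chord_matched ad).
case: existsP => [[d' /andP[ad' d'N]]|h].
  have := chord_inj mE ad ad'.
  move=> /(@mod_window N.+1 a) e; have -> : d = d' by have := ltn_ord d'; lia.
  by rewrite d'N.
case: ifP => // dN2; case: h; exists (inZp d).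
by rewrite /= modn_small ?ad ?dN2 //; lia.
Qed.

Lemma short_word_periodic E r t :
  (forall a b, chord E (a + r) (b + r) = chord E a b) ->
  matching E -> short_word E (t + r) = short_word E t.
Proof.
move=> inv mE; have mi := matched_shift t mE inv.
rewrite /short_word mi; congr (if _ then _ else _).
by apply: eq_existsb => d; rewrite addnAC inv.
Qed.

Lemma chord_gap E a b : matching E -> chord E a b ->
  exists d, [/\ (0 < d < N.+1)%N, chord E a (a + d) & b = (a + d)%N %[mod N.+1]].
Proof.
move=> mE ab; have lb := lift_from_bound N a b; exists (lift_from N a b - a)%N.
have e : (a + (lift_from N a b - a) = lift_from N a b)%N by lia.
split; rewrite ?e ?chord_lift ?lift_from_mod //.
have [e'|//] : lift_from N a b = a \/ (0 < lift_from N a b - a < N.+1)%N by lia.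
by case: (chord_neq mE ab); rewrite -(lift_from_mod N a b) e'.
Qed.

(** A chord under the short side of another one has its own short side there. *)
Lemma short_word_orients E : matching E -> diameter_free E ->
  orients E (short_word E).
Proof.
move=> mE dE.
have per t : short_word E (t + N.+1) = short_word E t.
  by apply: short_word_periodic => // a b; apply: chord_mod; rewrite modnDr.
split=> //.
- by move=> t; rewrite /short_word; case: ifP => // _; case: ifP.
- move=> t; rewrite /short_word; case: existsP => [[d /andP[/chord_matched ->]]|] //.
  by case: matched.
- move=> a b /(chord_gap mE)[d [dN ad e]].
  rewrite (periodic_mod per e) (short_word_chord mE ad dN).
  rewrite (@short_word_chord _ _ (N.+1 - d)) //; last by lia.
    by have := dE _ _ ad; do 2!case: ifP; rewrite ?opprK //; lia.
  rewrite chordC (@chord_mod _ _ _ a _ (a + d)) //.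
  by rewrite -addnA subnKC ?modnDr //; lia.
move=> i j c d ic cd dj jn ij si cdE.
have := @short_word_chord E i (j - i) mE; have := @short_word_chord E c (d - c) mE.
rewrite !subnKC ?ij ?cdE; try lia.
by move=> -> // ; last (by lia); rewrite si => /(_ isT); do 2!case: ifP => //; lia.
Qed.

(** A chord encloses itself: a marked chord is reversed in [mark_word]. *)
Definition encloses_mark m (a b : nat) : bool :=
  [exists u : 'I_N.+1, exists v : 'I_N.+1,
     [&& (a <= u)%N, (u < v)%N, (v <= b)%N & m == Some [set u; v]]].

Lemma encloses_markP m a b : reflect
  (exists u v : 'I_N.+1,
     [/\ (a <= u)%N, (u < v)%N, (v <= b)%N & m = Some [set u; v]])
  (encloses_mark m a b).
Proof.
apply: (iffP existsP) => [[u /existsP[v /and4P[h1 h2 h3 /eqP h4]]]|].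
  by exists u, v.
by case=> u [v [h1 h2 h3 ->]]; exists u; apply/existsP; exists v; apply/and4P.
Qed.

Lemma encloses_mark_sub m a b a' b' : (a' <= a)%N -> (b <= b')%N ->
  encloses_mark m a b -> encloses_mark m a' b'.
Proof.
move=> ha hb /encloses_markP[u [v [h1 h2 h3 e]]]; apply/encloses_markP.
by exists u, v; split=> //; lia.
Qed.

Lemma ordered_pair_inj (u v u' v' : 'I_N.+1) : (u < v)%N -> (u' < v')%N ->
  [set u; v] = [set u'; v'] -> u = u' /\ v = v'.
Proof.
move=> uv uv' /set2_eqE[//|[e e']]; move: uv uv'; rewrite e e'; lia.
Qed.

Lemma encloses_mark_meet m a b a' b' : encloses_mark m a b ->
  encloses_mark m a' b' -> (a < b')%N /\ (a' < b)%N.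
Proof.
move=> /encloses_markP[u [v [h1 h2 h3 ->]]] /encloses_markP[u' [v' [h1' h2' h3']]].
by case=> /(ordered_pair_inj h2 h2')[? ?]; subst; lia.
Qed.

(** Each chord runs from its smaller to its larger end point, except that the
    chords enclosing the mark are reversed. Geometrically, the sides swept from
    start to end avoid the region next to the marked chord on its inner side, or
    the region at the cut of the circle when there is no mark. *)
Definition mark_word E m (t : nat) : int :=
  let a := (t %% N.+1)%N in
  if [exists b : 'I_N.+1, chord E a b &&
        (if (a < b)%N then ~~ encloses_mark m a b else encloses_mark m b a)]
  then 1 else if matched E a then -1 else 0.

Lemma mark_word_chord E m a b : matching E -> (a < b < N.+1)%N -> chord E a b ->
  mark_word E m a = (if encloses_mark m a b then -1 else 1) /\
  mark_word E m b = (if encloses_mark m a b then 1 else -1).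
Proof.
move=> mE ab cab; have [aN bN] : (a < N.+1 /\ b < N.+1)%N by lia.
have [ltab ltba] : (a < b)%N /\ (b < a)%N = false by lia.
have part x y (z : 'I_N.+1) : (y < N.+1)%N -> chord E x y -> chord E x z ->
    z = y :> nat.
  by move=> yN /(chord_inj mE) h /h; rewrite !modn_small.
have cba : chord E b a by rewrite chordC.
rewrite /mark_word !(modn_small aN) !(modn_small bN).
rewrite (chord_matched cab) (chord_matched cba); split.
  case: existsP => [[z /andP[/(part _ _ _ bN cab) ->]]|h].
    by rewrite ltab => /negbTE->.
  case: ifPn => // ne; case: h; exists (inZp b).
  by rewrite /= (modn_small bN) cab ne ltab.
case: existsP => [[z /andP[/(part _ _ _ aN cba) ->]]|h].
  by rewrite ltba => ->.
case: ifP => // ne; case: h; exists (inZp a).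
by rewrite /= (modn_small aN) cba ltba ne.
Qed.

Lemma mark_word_mod E m t : mark_word E m t = mark_word E m (t %% N.+1)%N.
Proof. by rewrite /mark_word modn_mod. Qed.

(** For a chord that is not reversed, the chords under it are not reversed
    either. For a reversed one, the side swept passes through the cut of the
    circle; a chord there either encloses it, and is reversed too, or is disjoint
    from it, and does not enclose the mark. *)
Lemma mark_word_orients E m : matching E -> orients E (mark_word E m).
Proof.
move=> mE; have per t : mark_word E m (t + N.+1) = mark_word E m t.
  by rewrite mark_word_mod modnDr -mark_word_mod.
split=> //.
- by move=> t; rewrite /mark_word; case: ifP => // _; case: ifP.
- move=> t; rewrite -(@matched_mod _ E (t %% N.+1)) ?modn_mod // /mark_word.
  case: existsP => [[d /andP[/chord_matched ->]]|] //.
  by case: matched.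
- move=> a b ab; rewrite mark_word_mod [mark_word E m a]mark_word_mod.
  have [aN bN] : (a %% N.+1 < N.+1 /\ b %% N.+1 < N.+1)%N by rewrite !ltn_pmod.
  have := chord_neq mE ab.
  have {ab} : chord E (a %% N.+1) (b %% N.+1).
    by rewrite (@chord_mod _ _ _ a _ b) ?modn_mod.
  move: {a b}(a %% N.+1)%N (b %% N.+1)%N aN bN => a b aN bN.
  wlog lt : a b aN bN / (a < b)%N => [th ab ne|ab _].
    have [lt|lt|//] := ltngtP a b; first exact: th.
    by rewrite (th b a) ?opprK 1?chordC // => e; case: ne.
  have [|-> ->] := mark_word_chord m mE _ ab; first by lia.
  by case: ifP; rewrite ?opprK.
(* The condition for a start [i] in the first turn; the general case follows by
   subtracting whole turns. *)
have base i j c d : (i < N.+1)%N -> (i < c)%N -> (c < d)%N -> (d < j)%N ->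
    (j < i + N.+1)%N -> chord E i j -> mark_word E m i = 1 -> chord E c d ->
    mark_word E m c = 1.
  move=> iN ic cd dj jn ij si cdE.
  have sub y : (N.+1 <= y)%N -> y = (y - N.+1)%N %[mod N.+1].
    by move=> le; rewrite -{1}(subnK le) modnDr.
  have [jN|Nj] := ltnP j N.+1.
    have [|e _] := mark_word_chord m mE _ ij; first by lia.
    have [|-> _] := mark_word_chord m mE _ cdE; first by lia.
    case: ifP => // h; move: e; rewrite si (encloses_mark_sub _ _ h) //; lia.
  rewrite (chord_mod _ (erefl _) (sub j Nj)) chordC in ij.
  have [|_ e] := mark_word_chord m mE _ ij; first by lia.
  have {e} mi : encloses_mark m (j - N.+1) i by move: e; rewrite si; case: ifP.
  have [dN|Nd] := ltnP d N.+1.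
    have [|-> _] := mark_word_chord m mE _ cdE; first by lia.
    by case: ifP => // /(encloses_mark_meet mi); lia.
  rewrite (chord_mod _ (erefl _) (sub d Nd)) in cdE.
  have [cN|Nc] := ltnP c N.+1.
    rewrite chordC in cdE.
    have [|_ ->] := mark_word_chord m mE _ cdE; first by lia.
    by rewrite (encloses_mark_sub _ _ mi) //; lia.
  rewrite (chord_mod _ (sub c Nc) (erefl _)) in cdE.
  rewrite (periodic_mod per (sub c Nc)).
  have [|-> _] := mark_word_chord m mE _ cdE; first by lia.
  by case: ifP => // /(encloses_mark_meet mi); lia.
move=> i j c d ic cd dj jn ij si cdE.
set q := (i %/ N.+1)%N; have e := divn_eq i N.+1.
have sub y : (i <= y)%N -> y = (y - q * N.+1)%N %[mod N.+1].
  have le : (q * N.+1 <= i)%N by rewrite e leq_addr.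
  by move=> le'; rewrite -{1}(subnK (leq_trans le le')) addnC modnMDl.
rewrite (periodic_mod per (sub c _)); last by lia.
have le : (q * N.+1 <= i)%N by rewrite e leq_addr.
apply: (base (i - q * N.+1) (j - q * N.+1) _ (d - q * N.+1))%N; try lia.
- by rewrite -(chord_mod _ (sub _ _) (sub _ _)) //; lia.
- by rewrite -(periodic_mod per (sub i _)).
by rewrite -(chord_mod _ (sub _ _) (sub _ _)) //; lia.
Qed.

Definition mark_in E m : bool := if m is Some e then e \in E else true.

(** The word tells which chords enclose the mark. Hence two marks with the same
    word enclose each other. *)
Lemma mark_word_inj E m m' : matching E -> mark_in E m -> mark_in E m' ->
  mark_word E m =1 mark_word E m' -> m = m'.
Proof.
move=> mE; have key m1 m2 e : mark_in E m1 ->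
    mark_word E m1 =1 mark_word E m2 -> m1 = Some e ->
    exists u v u' v' : 'I_N.+1, [/\ (u < v)%N, e = [set u; v],
      (u <= u')%N /\ (v' <= v)%N, (u' < v')%N & m2 = Some [set u'; v']].
  move=> h1 eqw e1; rewrite e1 in h1; have [a [b [ab def cab]]] := edgeE mE h1.
  have [w1 _] := mark_word_chord m1 mE ab cab.
  have [w2 _] := mark_word_chord m2 mE ab cab.
  have n1 : encloses_mark m1 a b.
    apply/encloses_markP; exists (inZp a), (inZp b).
    by rewrite e1 def /= !modn_small; try lia; split=> //; lia.
  have /encloses_markP[u' [v' [h2 h3 h4 e2]]] : encloses_mark m2 a b.
    by move: w2; rewrite -eqw w1 n1; case: ifP.
  exists (inZp a), (inZp b), u', v'; rewrite /= !modn_small; try lia.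
  by split=> //; lia.
move=> h h' eqw; case: m m' h h' eqw => [e|] [e'|] // h h' eqw.
- have [u [v [u1 [v1 [uv E0 [h1 h2] h3 [E1]]]]]] := key _ _ _ h eqw (erefl _).
  have [u2 [v2 [u3 [v3 [uv' E2 [h1' h2'] h3' [E3]]]]]] :=
    key _ _ _ h' (fsym eqw) (erefl _).
  rewrite E1 in E2; rewrite E0 in E3; have [eu ev] := ordered_pair_inj h3 uv' E2.
  have [eu3 ev3] := ordered_pair_inj uv h3' E3.
  rewrite E0 E1; congr (Some [set _; _]); apply/val_inj => /=.
    by move: h1 h1'; rewrite -eu -eu3; lia.
  by move: h2 h2'; rewrite -ev -ev3; lia.
- by have [u [v [u1 [v1 []]]]] := key _ _ _ h eqw (erefl _).
by have [u [v [u1 [v1 []]]]] := key _ _ _ h' (fsym eqw) (erefl _).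
Qed.

(** The mark is the shortest of the chords [a < b] whose start is [b]: by nesting
    the reversed chords form a chain, so that every reversed chord encloses the
    shortest one. Without reversed chords there is no mark. *)
Lemma mark_word_surj s : balanced N.+1 s ->
  exists2 m, mark_in (word_edges s) m & mark_word (word_edges s) m =1 s.
Proof.
move=> bs; set E := word_edges s; have [hs per _] := bs.
have mE : matching E := word_edges_matching bs.
have oE : orients E s := word_edges_orients bs.
suff [m mi hm] : exists2 m, mark_in E m & forall a b, (a < b < N.+1)%N ->
    chord E a b -> (s a == -1) = encloses_mark m a b.
  exists m => // t; rewrite mark_word_mod.
  rewrite -(@periodic_mod _ _ s (t %% N.+1) t per) ?modn_mod //.
  have : (t %% N.+1 < N.+1)%N by rewrite ltn_pmod.
  move: {t}(t %% N.+1)%N => t tN.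
  have [mt|nt] := boolP (matched E t); last first.
    have /eqP -> : s t == 0 by rewrite (orients_free oE).
    by apply/eqP; rewrite (orients_free (mark_word_orients m mE)).
  have [b bN tb] := matched_lift 0 mE mt; rewrite add0n in bN.
  have [lt|lt|e] := ltngtP t b; last by case: (chord_neq mE tb); rewrite e.
    have ltb : (t < b < N.+1)%N by lia.
    have [-> _] := mark_word_chord m mE ltb tb; rewrite -(hm _ _ ltb tb).
    have := orients_free oE t; rewrite mt => /negbT/eqP; have := hs t.
    by case: eqP => //; lia.
  have ltb : (b < t < N.+1)%N by lia.
  rewrite chordC in tb; have [_ ->] := mark_word_chord m mE ltb tb.
  rewrite -(hm _ _ ltb tb) (orients_opp oE tb).
  have := orients_free oE b; rewrite (chord_matched tb) => /negbT/eqP.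
  by have := hs b; case: eqP => //; lia.
(* [wrapped w]: some reversed chord has its end points at distance [w]. *)
pose wrapped w := [exists a : 'I_N.+1, exists b : 'I_N.+1,
  [&& (a < b)%N, chord E a b, s a == -1 & w == (b - a)%N]].
have [nw|] := boolP [forall a : 'I_N.+1, forall b : 'I_N.+1,
    [&& (a < b)%N & chord E a b] ==> (s a != -1)].
  exists None => // a b /andP[ab bN] cab.
  move/'forall_'forall_implyP: nw => /(_ (inZp a) (inZp b)).
  rewrite /= !modn_small ?ab ?cab; try lia.
  move=> /(_ isT)/negbTE->; apply/esym/negbTE/encloses_markP.
  by case=> u [v []].
rewrite negb_forall => /existsP[a0]; rewrite negb_forall => /existsP[b0].
rewrite negb_imply negbK => /andP[/andP[ab0 cab0] sa0].
have exw : exists w, wrapped w.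
  by exists (b0 - a0)%N; apply/existsP; exists a0; apply/existsP; exists b0;
    rewrite ab0 cab0 sa0 eqxx.
case: (ex_minnP exw) => w /existsP[u /existsP[v /and4P[uv cuv /eqP su /eqP w_uv]]] min.
exists (Some [set u; v]); first by move: cuv; rewrite /chord !valZpK.
move=> a b /andP[ab bN] cab; apply/eqP/encloses_markP => [sa|]; last first.
  case=> u' [v' [h1 h2 h3 [e]]]; have [eu ev] := ordered_pair_inj uv h2 e; subst u' v'.
  have sa1 : s a <> 0.
    by move/eqP; rewrite (orients_free oE) (chord_matched cab).
  have sa2 : s a <> 1.
    move=> sa; have [e1|lt] : a = u \/ (a < u)%N by lia.
      by move: sa; rewrite e1 su.
    have [e1|lt'] : b = v \/ (v < b)%N by lia.
      rewrite e1 chordC in cab; rewrite chordC in cuv.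
      have := chord_inj mE cab cuv.
      by have := ltn_ord u; move=> uN /(@mod_window N.+1 0 a u); lia.
    have := @orients_inside _ _ _ oE a b u v lt uv lt' _ cab sa cuv.
    by rewrite su; lia.
  by have := hs a; lia.
exists u, v; have vN := ltn_ord v.
have mab := min (b - a)%N; have {mab} le : (w <= b - a)%N.
  apply: mab; apply/existsP; exists (inZp a); apply/existsP; exists (inZp b).
  by rewrite /= !modn_small ?ab ?cab ?sa ?eqxx //; lia.
have sb : s b = 1 by rewrite (orients_opp oE cab) sa.
have sv : s v = 1 by rewrite (orients_opp oE cuv) su.
(* A chord under the swept side of a reversed chord is not reversed. *)
have noin i j c d (h1 : (j < i)%N) (h2 : (i < c)%N) (h3 : (c < d)%N)
  (h4 : (d < j + N.+1)%N) (ij : chord E j i) (si : s i = 1) (cdE : chord E c d) :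
    s c = 1.
  have hij : chord E i (j + N.+1).
    by rewrite chordC (@chord_mod _ _ _ j _ i) ?modnDr.
  by apply: (orients_inside oE h2 h3 h4 _ hij si cdE); lia.
have modinj x y : (x < N.+1)%N -> (y < N.+1)%N -> x = y %[mod N.+1] -> x = y.
  by move=> xN yN; rewrite !modn_small.
have shared : a = u -> b = v.
  move=> e; rewrite e in cab; apply: modinj; rewrite ?(chord_inj mE cab cuv) //; lia.
have shared' : b = v -> a = u.
  move=> e; rewrite e chordC in cab; rewrite chordC in cuv.
  by apply: modinj; rewrite ?(chord_inj mE cab cuv) //; lia.
have ns1 : a <> v.
  by move=> e; move: sa; rewrite e sv.
have ns2 : b <> u.
  by move=> e; move: sb; rewrite e su.
have cr1 : ~~ ((a < u) && (u < b) && (b < v))%N.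
  apply/negP => /andP[/andP[h1 h2] h3].
  by case: (chord_nocross mE h1 h2 h3 _ cab cuv); lia.
have cr2 : ~~ ((u < a) && (a < v) && (v < b))%N.
  apply/negP => /andP[/andP[h1 h2] h3].
  by case: (chord_nocross mE h1 h2 h3 _ cuv cab); lia.
have d1 : ~~ (b < u)%N.
  apply/negP => h; have := noin b a u v ab h uv; rewrite su.
  by move=> /(_ _ cab sb cuv); lia.
have d2 : ~~ (v < a)%N.
  apply/negP => h; have := noin v u a b uv h ab; rewrite sa.
  by move=> /(_ _ cuv sv cab); lia.
split=> //; lia.
Qed.

End Orientations.

(** * Rotation-invariant matchings and periodic balanced words *)

Lemma balanced_dvd r n s : (r %| n)%N -> balanced r s -> balanced n s.
Proof.
case/dvdnP => q ->; case=> hs per h0; split=> //.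
  by move=> t; apply: (periodic_mod per); rewrite addnC modnMDl.
by rewrite height_periodicM // h0 mul0rn.
Qed.

Lemma dvdn_proper_double r n : (0 < n)%N -> (r %| n)%N -> r <> n -> (r.*2 <= n)%N.
Proof.
move=> n0 /dvdnP[[|[|q]] e] rn; rewrite ?mul0n ?mul1n in e; try lia.
Qed.

Section Symmetric.
Context {N : nat}.
Implicit Types (E : {set {set 'I_N.+1}}) (s : nat -> int).
Implicit Types (m : option {set 'I_N.+1}).

Lemma chord_word_edges_shift r s a b : (r %| N.+1)%N -> balanced r s ->
  let E := word_edges s : {set {set 'I_N.+1}} in
  chord E (a + r) (b + r) = chord E a b.
Proof.
move=> rn br /=; have bs := balanced_dvd rn br; rewrite !chord_word_edges //.
have lr x y : lift_from N (x + r) (y + r) = (lift_from N x y + r)%N.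
  have := lift_from_bound N x y => h; apply: lift_from_unique; first by lia.
  by apply/eqP; rewrite eqn_modDr lift_from_mod.
by rewrite /linked !lr !(excursion_shift _ _ br).
Qed.

(** An excursion is shorter than the period [r], hence at most half a turn. *)
Lemma word_edges_short r s : (r.*2 <= N.+1)%N -> (0 < r)%N -> (r %| N.+1)%N ->
  balanced r s ->
  diameter_free (word_edges s : {set {set 'I_N.+1}}) /\
  short_word (word_edges s : {set {set 'I_N.+1}}) =1 s.
Proof.
move=> r2 r0 rn br; have bs := balanced_dvd rn br; set E := word_edges s.
have mE : matching E := word_edges_matching bs.
have oE : orients E s := word_edges_orients bs.
have [hs per _] := bs.
have gap a d : (0 < d < N.+1)%N -> chord E a (a + d) ->
    (s a = 1 /\ (d < r)%N) \/ (s a = -1 /\ (N.+1 - d < r)%N).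
  move=> dN; rewrite chord_word_edges // linked_window; last by lia.
  case/orP => h; [left|right]; have := excursion_ltD r0 br h.
    by have [-> _] := excursion_steps hs h; lia.
  by have [_] := excursion_steps hs h; rewrite per => ->; lia.
split=> [a d ad e|t]; first by have := gap a d ltac:(lia) ad; lia.
have [mt|nt] := boolP (matched E t); last first.
  have /eqP -> : s t == 0 by rewrite (orients_free oE).
  rewrite /short_word (negbTE nt); case: existsP => // -[d /andP[/chord_matched]].
  by rewrite (negbTE nt).
have [b _ tb] := matched_lift 0 mE mt.
have [d [dN td _]] := chord_gap mE tb.
rewrite (short_word_chord mE td dN).
by case: (gap _ _ dN td) => -[-> lt]; case: ifP => //; lia.
Qed.

(** The mark selects the orientation for the trivial rotation, the only one that
    is relevant to marked matchings; the centre of the circle selects it for the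
    others. *)
Definition coding_word r E m : nat -> int :=
  if r == N.+1 then mark_word E m else short_word E.

(** The pairs (matching, mark) invariant under the rotation by a divisor [r] of
    [N.+1]. Diameters have to be excluded for proper divisors, because a
    half-turn may preserve one, and a diameter has no shorter side. *)
Record admissible r E m : Prop := Admissible {
  admissible_matching : matching E;
  admissible_mark : mark_in E m;
  admissible_rot : forall a b, chord E (a + r) (b + r) = chord E a b;
  admissible_proper : r <> N.+1 -> m = None /\ diameter_free E }.

Lemma coding_word_orients r E m : admissible r E m -> orients E (coding_word r E m).
Proof.
case=> mE _ _ pr; rewrite /coding_word; case: eqP => [_|/pr[_ dE]].
  exact: mark_word_orients.
exact: short_word_orients.
Qed.

Lemma coding_word_balanced r E m : (r %| N.+1)%N -> admissible r E m ->
  balanced r (coding_word r E m).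
Proof.
move=> rn ad; have oE := coding_word_orients ad; case: ad => mE _ rot _.
have [hs per h0] := orients_balanced mE oE.
have perr t : coding_word r E m (t + r) = coding_word r E m t.
  move: per; rewrite /coding_word; case: eqP => [-> //|_ _].
  exact: short_word_periodic.
split=> //; case/dvdnP: rn h0 => q e; rewrite [in X in height _ X]e.
rewrite height_periodicM // => /eqP; rewrite mulrn_eq0 => /orP[|/eqP //].
by move/eqP => q0; move: e; rewrite q0.
Qed.

Lemma coding_word_inj r E m E' m' : admissible r E m -> admissible r E' m' ->
  coding_word r E m =1 coding_word r E' m' -> E = E' /\ m = m'.
Proof.
move=> ad ad' eqw; have eE : E = E'.
  apply: (orients_inj (admissible_matching ad) (admissible_matching ad')
    (coding_word_orients ad)).
  have oE' := coding_word_orients ad'.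
  have eqw' t : coding_word r E m t = coding_word r E' m' t := eqw t.
  split=> [t|t|t|a b|i j c d]; rewrite !eqw'.
  - exact: (orients_step oE').
  - exact: (orients_periodic oE').
  - exact: (orients_free oE').
  - exact: (orients_opp oE').
  exact: (orients_inside oE').
split=> //; move: eqw; rewrite -{}eE in ad' *; rewrite /coding_word.
case: eqP => [_|rn _].
  exact: mark_word_inj (admissible_matching ad) (admissible_mark ad)
    (admissible_mark ad').
by have [-> _] := admissible_proper ad rn; have [-> _] := admissible_proper ad' rn.
Qed.

Lemma coding_word_surj r s : (0 < r)%N -> (r %| N.+1)%N -> balanced r s ->
  exists E m, admissible r E m /\ coding_word r E m =1 s.
Proof.
move=> r0 rn br; have bs := balanced_dvd rn br; exists (word_edges s).
have mE : matching (word_edges s : {set {set 'I_N.+1}}) := word_edges_matching bs.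
rewrite /coding_word; case: eqP => [e|ne].
  have [m mi hm] := mark_word_surj bs; exists m; split=> //.
  by split=> // a b; apply: chord_word_edges_shift.
have [dE hs] := word_edges_short (dvdn_proper_double (ltn0Sn N) rn ne) r0 rn br.
by exists None; split=> //; split=> // a b; apply: chord_word_edges_shift.
Qed.

End Symmetric.

(** * The twist in unrolled coordinates *)

Section Coordinates.
Context {N : nat}.
Implicit Types (x y : NCCB N.+1).

Definition edges x : {set {set 'I_N.+1}} := (val x).1.1.
Definition loops x : {set 'I_N.+1} := (val x).1.2.
Definition mark x : option {set 'I_N.+1} := (val x).2.

Definition marked x (a b : nat) : bool := mark x == Some [set inZp a; inZp b].

(** The loop at [t], negated once for each turn already made around the circle.
    The quotient grows when [t] goes from a multiple of [N.+1] to its successor,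
    which is where the flip acts in the twist. *)
Definition loop_state x (t : nat) : bool :=
  (inZp t \in loops x) (+) odd ((t + N) %/ N.+1).

Lemma edges_matching x : matching (edges x).
Proof.
have := valP x; rewrite /edges; case: (val x) => [[E L] m] /=.
by case/and5P => h1 h2 h3 _ _; apply/and3P.
Qed.

Lemma mark_in_edges x : mark_in (edges x) (mark x).
Proof.
have := valP x; rewrite /edges /mark; case: (val x) => [[E L] m] /=.
by case/and5P.
Qed.

Lemma loops_unmatched x t : matched (edges x) t -> inZp t \notin loops x.
Proof.
have := valP x; rewrite /matched /edges /loops; case: (val x) => [[E L] m] /=.
by case/and5P => _ _ _ d _; apply: contraL => tL; rewrite (disjointFr d).
Qed.

(** At matched vertices there is no loop, so the loop bits of the unmatched ones
    suffice. *)
Lemma conf_ext x y : (forall a b, chord (edges x) a b = chord (edges y) a b) ->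
  (forall a b, marked x a b = marked y a b) ->
  (forall t, ~~ matched (edges x) t -> loop_state x t = loop_state y t) -> x = y.
Proof.
move=> hc hm hl.
have eE : edges x = edges y.
  by apply: (chord_ext (edges_matching x) (edges_matching y)) => a b; rewrite hc.
have sub z w e : (forall a b, marked z a b = marked w a b) -> mark z = Some e ->
    mark w = Some e.
  move=> h ez; have := mark_in_edges z; rewrite ez => eE'.
  have [a [b [_ def _]]] := edgeE (edges_matching z) eE'.
  by have := h a b; rewrite /marked ez def eqxx => /esym/eqP.
have em : mark x = mark y.
  case ex: (mark x) => [e|]; first by rewrite (sub x y e).
  by case ey: (mark y) => [e|] //; rewrite -ex (sub y x e).
have eL : loops x = loops y.
  apply/setP => i; rewrite -(valZpK i).
  have [mi|ni] := boolP (matched (edges x) i).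
    have mi' : matched (edges y) i by rewrite -eE.
    by rewrite (negbTE (loops_unmatched mi)) (negbTE (loops_unmatched mi')).
  by apply: addIb (hl _ ni).
apply: val_inj; move: eE em eL; rewrite /edges /mark /loops.
by case: (val x) (val y) => [[E L] m] [[E' L'] m'] /= -> -> ->.
Qed.

Lemma loop_state_antiperiodic x t : loop_state x (t + N.+1) = ~~ loop_state x t.
Proof.
rewrite /loop_state (@inZp_mod _ (t + N.+1) t) ?modnDr //.
by rewrite addnAC divnDr ?dvdnn // divnn addn1 /= addbN.
Qed.

Lemma ordS_inZp t : @ordS N.+1 (inZp t) = inZp t.+1.
Proof. by apply: val_inj; rewrite /= -addn1 modnDml addn1. Qed.

Lemma rot_edge_inZp a b :
  rot_edge [set inZp a; inZp b] = [set inZp a.+1; inZp b.+1 : 'I_N.+1].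
Proof. by rewrite /rot_edge imsetU !imset_set1 !ordS_inZp. Qed.

Variable hn : (0 < N.+1)%N.

Lemma edges_twist x : edges (twist hn x) = @rot_edge N.+1 @: edges x.
Proof.
rewrite permE; case: x => [[[E L] m] hx]; rewrite /edges /=.
by case: ifP => // _; case: ifP.
Qed.

Lemma mark_twist x : mark (twist hn x) = omap (@rot_edge N.+1) (mark x).
Proof.
rewrite permE; case: x => [[[E L] m] hx]; rewrite /mark /=.
by case: ifP => // _; case: ifP.
Qed.

Lemma chord_twist x a b :
  chord (edges (twist hn x)) a.+1 b.+1 = chord (edges x) a b.
Proof.
rewrite /chord edges_twist -rot_edge_inZp mem_imset //; exact: rot_edge_inj.
Qed.

Lemma marked_twist x a b : marked (twist hn x) a.+1 b.+1 = marked x a b.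
Proof.
rewrite /marked mark_twist -rot_edge_inZp; case: (mark x) => //= e.
by rewrite !(inj_eq Some_inj) (inj_eq (@rot_edge_inj _)).
Qed.

Lemma matched_twist x t : matched (edges (twist hn x)) t.+1 = matched (edges x) t.
Proof.
rewrite /matched edges_twist cover_rot -ordS_inZp mem_imset //; exact: ordS_inj.
Qed.

(** The flip toggles the loop at vertex 1 exactly when the number of turns in
    [loop_state] changes its parity. *)
Lemma loop_state_twist x t : ~~ matched (edges x) t ->
  loop_state (twist hn x) t.+1 = loop_state x t.
Proof.
move=> nt; have qS : ((t.+1 + N) %/ N.+1 = (t + N) %/ N.+1 + (N.+1 %| t))%N.
  by rewrite addSn divnS // addnC -addnS dvdn_addl.
have v1 : (inZp t == vertex1 hn :> 'I_N.+1) = (N.+1 %| t)%N.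
  by rewrite -val_eqE.
rewrite /loop_state qS oddD; move: nt; rewrite permE.
case: x => [[[E L] m] hx]; rewrite /matched /edges /loops /= => nt.
rewrite -ordS_inZp -v1.
have inr (S : {set 'I_N.+1}) : (@ordS N.+1 (inZp t) \in @ordS N.+1 @: S) = (inZp t \in S).
  by rewrite mem_imset //; exact: ordS_inj.
case: eqP => [e|ne] /=; rewrite ?addbF ?addbT.
  rewrite -e (negbTE nt); case: ifP => tL; rewrite /= inr !inE eqxx ?tL /=.
    by case: odd.
  by case: odd.
have {}ne : inZp t != vertex1 hn by apply/eqP.
by case: ifP => _; last case: ifP => _; rewrite /= inr ?inE ?(negbTE ne).
Qed.

Lemma twist_iter k x :
  [/\ forall a b, chord (edges ((twist hn ^+ k)%g x)) (a + k) (b + k)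
                  = chord (edges x) a b,
      forall a b, marked ((twist hn ^+ k)%g x) (a + k) (b + k) = marked x a b,
      forall t, matched (edges ((twist hn ^+ k)%g x)) (t + k) = matched (edges x) t &
      forall t, ~~ matched (edges x) t ->
        loop_state ((twist hn ^+ k)%g x) (t + k) = loop_state x t].
Proof.
elim: k => [|k [h1 h2 h3 h4]].
  by split=> *; rewrite expg0 perm1 !addn0.
split=> [a b|a b|t|t nt]; rewrite expgSr permM !addnS.
- by rewrite chord_twist h1.
- by rewrite marked_twist h2.
- by rewrite matched_twist h3.
by rewrite loop_state_twist ?h3 ?h4.
Qed.

(** The rotated configuration is read at positions shifted by [k]; any position
    has a representative of this form, and moving to it negates both loop bits
    equally often. *)
Lemma twist_fixP k x : reflect
  [/\ forall a b, chord (edges x) (a + k) (b + k) = chord (edges x) a b,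
      forall a b, marked x (a + k) (b + k) = marked x a b &
      forall t, ~~ matched (edges x) t -> loop_state x (t + k) = loop_state x t]
  ((twist hn ^+ k)%g x == x).
Proof.
have [h1 h2 h3 h4] := twist_iter k x.
apply: (iffP eqP) => [e|[f1 f2 f3]]; first by move: h1 h2 h4; rewrite !e.
have sh a : (a + k * N + k = a + k * N.+1)%N by rewrite -addnA -mulnSr.
have shm a : a = (a + k * N + k)%N %[mod N.+1] by rewrite sh addnC modnMDl.
have lsM z t : loop_state z (t + k * N.+1) = loop_state z t (+) odd k.
  elim: (k) => [|j IH]; first by rewrite mul0n addn0 addbF.
  by rewrite mulSnr addnA loop_state_antiperiodic IH /= addbN.
have mm z a b : marked z a b = marked z (a + k * N + k) (b + k * N + k).
  by rewrite /marked (inZp_mod (shm a)) (inZp_mod (shm b)).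
apply: conf_ext => [a b|a b|t nt].
- rewrite (chord_mod _ (shm a) (shm b)) h1 -f1.
  by rewrite -(chord_mod _ (shm a) (shm b)).
- by rewrite mm h2 -f2 -mm.
have nt' : ~~ matched (edges x) (t + k * N).
  by rewrite -h3 -(matched_mod _ (shm t)).
by apply: (@addIb (odd k)); rewrite -!lsM -sh h4 // -f3 // sh.
Qed.

End Coordinates.

(** * Counting the configurations fixed by an even power of the twist *)

Lemma height_pair (s : nat -> int) (a : nat -> bool) r :
  (forall t, s t = (a t)%:Z + (a (t + r)%N)%:Z - 1) ->
  height s r = height (fun t => (a t)%:Z) (r + r) - r%:Z.
Proof.
move=> hs; rewrite /height big_split_ord /= -big_split /=.
have -> : r%:Z = \sum_(i < r) 1 by rewrite sumr_const card_ord natz.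
by rewrite -sumrB; apply: eq_bigr => i _; rewrite hs addnC.
Qed.

Lemma height_parity (s : nat -> int) t : (forall i, s i = 1 \/ s i = -1) ->
  exists z, height s t = t%:Z - z * 2%:Z.
Proof.
move=> hs; elim: t => [|t [z IH]]; first by exists 0; rewrite height0; lia.
by rewrite heightS IH; case: (hs t) => ->; [exists z|exists (z + 1)]; lia.
Qed.

(** In a perfect matching every step is odd, so that the height has the parity of
    the position and an excursion covers an even number of vertices; this applies
    to either side of the diameter. The word without mark serves as an arbitrary
    orientation. *)
Lemma perfect_diameter N (E : {set {set 'I_N.+1}}) a d : matching E ->
  (forall t, matched E t) -> chord E a (a + d) -> d.*2 = N.+1 -> odd d.
Proof.
move=> mE mt ad dN; pose s := mark_word E None.
have oE : orients E s := mark_word_orients None mE.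
have hs t : s t = 1 \/ s t = -1.
  have := orients_free oE t; rewrite mt => /negbT/eqP.
  by have := orients_step oE t; lia.
have key i j : excursion s i j -> ((j - i).+1 %% 2)%N = 0%N.
  move=> h; have [z1 e1] := height_parity i hs.
  have [z2 e2] := height_parity j.+1 hs.
  by case/excursionP: h => ij e _; lia.
case: (hs a) => sa.
  have h : excursion s a (a + d) by apply: (orients_arc mE oE) => //; lia.
  by have := key _ _ h; rewrite addKn; lia.
have h : excursion s (a + d) (a + N.+1).
  apply: (orients_arc mE oE); first by lia.
    by rewrite chordC (@chord_mod _ _ _ a _ (a + d)) ?modnDr.
  by rewrite (orients_opp oE ad) sa.
by have := key _ _ h; lia.
Qed.

Section Counting.
Context {N m k : nat}.
Variable hn : (0 < N.+1)%N.
Hypothesis nE : N.+1 = (m * k)%N.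
Implicit Types x : NCCB N.+1.

Let r := if odd k then m else (2 * m)%N.

Let m0 : (0 < m)%N. Proof. by move: nE; case: (m). Qed.
Let k0 : (0 < k)%N. Proof. by move: nE; case: (k) => //; rewrite muln0. Qed.
Let r0 : (0 < r)%N. Proof. by rewrite /r; case: ifP => _; lia. Qed.

Let kE : k = (odd k + 2 * k./2)%N.
Proof. by rewrite mul2n odd_double_half. Qed.

Lemma sym_period_dvd : (r %| N.+1)%N.
Proof.
rewrite nE /r; case: ifP => ko; first exact: dvdn_mulr.
by rewrite kE ko add0n mulnA (mulnC m) dvdn_mulr.
Qed.

(** Asking for [odd k] at each unmatched vertex makes the matching perfect when
    [k] is even. *)
Definition twisted_loops x := forall t, ~~ matched (edges x) t ->
  odd k /\ loop_state x (t + r) = ~~ loop_state x t.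

(** A diameter crosses its image under a rotation by less than half a turn. The
    only other case is a rotation by half a turn, which forces [k] even: then
    the matching is perfect and [perfect_diameter] makes the even number [r] odd.
    An invariant mark has its end points exchanged by the rotation, hence is a
    diameter. *)
Lemma admissible_sym x :
  (forall a b, chord (edges x) (a + r) (b + r) = chord (edges x) a b) ->
  (forall a b, marked x (a + r) (b + r) = marked x a b) ->
  (~~ odd k -> forall t, matched (edges x) t) ->
  admissible r (edges x) (mark x).
Proof.
move=> hc hm hp; have mE := edges_matching x; split=> //; first exact: mark_in_edges.
move=> rn; have r2 := dvdn_proper_double (ltn0Sn N) sym_period_dvd rn.
have dE : diameter_free (edges x).
  move=> a d ad dN.
  have [rd|rd] : (r < d)%N \/ r = d by lia.
    have := ad; rewrite -hc addnAC.
    by move/(chord_nocross mE _ _ _ _ ad); apply; lia.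
  have [ko|ke] := boolP (odd k).
    have k3 : (3 <= k)%N.
      have k1 : k <> 1%N by move=> k1; apply: rn; rewrite /r ko nE k1 muln1.
      by have := kE; rewrite ko; lia.
    have : (m * 3 <= m * k)%N by rewrite leq_mul2l k3 orbT.
    by move: rd; rewrite -nE /r ko; lia.
  have := perfect_diameter mE (hp ke) ad dN; rewrite -rd /r (negbTE ke).
  by rewrite mul2n odd_double.
split=> //; case em: (mark x) => [e|] //; exfalso.
have := mark_in_edges x; rewrite em => eE.
have [a [b [ab def cab]]] := edgeE mE eE.
have : marked x (a + r) (b + r) by rewrite hm /marked em def.
have smod c d : inZp c = inZp d :> 'I_N.+1 -> c = d %[mod N.+1].
  by move=> e'; apply/inZp_eqP; rewrite e'.
rewrite /marked em def => /eqP[/set2_eqE[[/smod ea _]|[/smod ea /smod eb]]].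
  by have := @mod_window N.+1 a a (a + r) _ _ ea; lia.
have e2 : a = (a + r + r)%N %[mod N.+1].
  by rewrite ea -modnDml eb modnDml.
have rr : (r.*2 = N.+1)%N.
  have [lt|//] : (r.*2 < N.+1)%N \/ r.*2 = N.+1 by lia.
  by have := @mod_window N.+1 a a (a + r + r) _ _ e2; lia.
by apply: (dE a r) => //; rewrite -(chord_mod _ (erefl _) eb).
Qed.

(** For odd [k], [m + N.+1] is a multiple of [2 * m], so that period [2 * m]
    together with the (anti-)period [N.+1] gives the (anti-)period [m]. For even
    [k], [N.+1] is itself a multiple of [2 * m], so an unmatched vertex would have
    a loop bit equal to its negation. *)
Lemma twist_fix_sym x : reflect
  (admissible r (edges x) (mark x) /\ twisted_loops x)
  ((twist hn ^+ (2 * m))%g x == x).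
Proof.
have mE := edges_matching x.
apply: (iffP (twist_fixP hn (2 * m) x)) => [[h1 h2 h3]|[ad tl]].
  have hc j a b : chord (edges x) (a + 2 * m * j) (b + 2 * m * j) = chord (edges x) a b.
    elim: j => [|j IH]; first by rewrite muln0 !addn0.
    by rewrite mulnSr 2!addnA h1 IH.
  have hk j a b : marked x (a + 2 * m * j) (b + 2 * m * j) = marked x a b.
    elim: j => [|j IH]; first by rewrite muln0 !addn0.
    by rewrite mulnSr 2!addnA h2 IH.
  have hl j t : ~~ matched (edges x) t -> loop_state x (t + 2 * m * j) = loop_state x t.
    move=> nt; elim: j => [|j IH]; first by rewrite muln0 addn0.
    by rewrite mulnSr addnA h3 ?IH // (matched_shift _ mE (hc j)).
  have per a : a = (a + N.+1)%N %[mod N.+1] by rewrite modnDr.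
  have [ko|ke] := boolP (odd k); last first.
    have perf t : matched (edges x) t.
      apply/negPn/negP => nt; have := hl k./2 t nt.
      have -> : (2 * m * k./2 = N.+1)%N.
        by rewrite nE [in RHS]kE (negbTE ke) add0n mulnA (mulnC m).
      by rewrite loop_state_antiperiodic; case: (loop_state x t).
    split; last by move=> t; rewrite perf.
    by apply: admissible_sym => [a b|a b|_] //; rewrite /r (negbTE ke).
  (* A shift by [m], followed by a full turn, is a multiple of [2 * m]. *)
  have e t : (t + m + N.+1 = t + 2 * m * k./2.+1)%N.
    by rewrite nE [in LHS]kE ko mulnDr muln1 mulnS mulnA (mulnC m 2); lia.
  split; last first.
    move=> t nt; split=> //; rewrite /r ko.
    by rewrite -[in RHS](hl k./2.+1 _ nt) -e loop_state_antiperiodic negbK.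
  apply: admissible_sym => [a b|a b|]; rewrite ?ko // /r ko.
    by rewrite (chord_mod _ (per _) (per _)) !e hc.
  by rewrite /marked (inZp_mod (per (a + m))) (inZp_mod (per (b + m))) !e; exact: hk.
have hc := admissible_rot ad; have hp := admissible_proper ad.
have e2 : (2 * m = r)%N \/ (odd k /\ 2 * m = r + r)%N.
  by rewrite /r; case: ifP => ko; [right|left] => //; split=> //; lia.
split.
- move=> a b; case: e2 => [->|[_ ->]]; first by rewrite hc.
  by rewrite !addnA !hc.
- move=> a b; have [rn|/eqP/hp[em _]] := eqVneq r N.+1; last by rewrite /marked em.
  have inN c : inZp (c + 2 * m) = inZp c :> 'I_N.+1.
    by apply: inZp_mod; case: e2 => [->|[_ ->]]; rewrite ?addnA rn ?modnDr.
  by rewrite /marked !inN.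
move=> t nt; have [ko l1] := tl t nt; case: e2 => [|[_ ->]].
  by rewrite /r ko; lia.
have [_ l2] := tl (t + r)%N ltac:(by rewrite (matched_shift _ mE hc)).
by rewrite addnA l2 l1 negbK.
Qed.


(** Since loop bits are negated by a shift of [r], the step of the coding word at
    [t] is [bit x t + bit x (t + r) - 1] ([coding_word_bit]). *)
Definition bit x (t : nat) : bool :=
  let w := coding_word r (edges x) (mark x) in
  (w t == 1) || ((w t == 0) && loop_state x t).

Let r2 : (2 * m = r)%N /\ ~~ odd k \/ (2 * m = r + r)%N /\ odd k.
Proof. by rewrite /r; case: ifP => ko; [right|left]; split=> //; lia. Qed.

Lemma coding_word_bit x t : admissible r (edges x) (mark x) -> twisted_loops x ->
  coding_word r (edges x) (mark x) t = (bit x t)%:Z + (bit x (t + r)%N)%:Z - 1.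
Proof.
move=> ad tl; have [hs per _] := coding_word_balanced sym_period_dvd ad.
rewrite /bit per; have oE := coding_word_orients ad.
have [mt|nt] := boolP (matched (edges x) t).
  have := orients_free oE t; rewrite mt => /negbT/eqP; have := hs t.
  by do 2!case: eqP => //=; lia.
have /eqP-> : coding_word r (edges x) (mark x) t == 0 by rewrite (orients_free oE).
by have [_ ->] := tl t nt; case: (loop_state x t).
Qed.

Lemma bit_periodic x t : admissible r (edges x) (mark x) -> twisted_loops x ->
  bit x (t + 2 * m) = bit x t.
Proof.
move=> ad tl; have [hs per _] := coding_word_balanced sym_period_dvd ad.
have per2 : coding_word r (edges x) (mark x) (t + 2 * m)
    = coding_word r (edges x) (mark x) t.
  by case: r2 => -[-> _]; rewrite ?addnA !per.
rewrite /bit per2; case: eqP => [//|_] /=; case: eqP => [e|//] /=.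
have oE := coding_word_orients ad.
have nt : ~~ matched (edges x) t by rewrite -(orients_free oE) e.
have [ko l1] := tl t nt; case: r2 => -[]; first by rewrite ko.
have nt' : ~~ matched (edges x) (t + r) by rewrite -(orients_free oE) per e.
by move=> -> _; have [_ l2] := tl _ nt'; rewrite addnA l2 l1 negbK.
Qed.

(** Summing [s] over [r] positions gives the number of ones of [a] over [r + r]
    positions minus [r]; for odd [k] this is one period of [a], for even [k] it is
    two periods. *)
Lemma balanced_bits (s : nat -> int) (a : nat -> bool) :
  (forall t, s t = (a t)%:Z + (a (t + r)%N)%:Z - 1) ->
  (forall t, a (t + 2 * m)%N = a t) ->
  (height s r == 0) = (#|[set i : 'I_(2 * m) | a i]| == m).
Proof.
move=> hs pa; have hc : height (fun t => (a t)%:Z) (2 * m)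
    = #|[set i : 'I_(2 * m) | a i]|%:Z.
  rewrite -sum1_card big_mkcond /= -natz natr_sum; apply: eq_bigr => i _.
  by rewrite inE; case: (a i).
rewrite (height_pair hs); case: r2 => -[e ko].
  have -> : (r + r = 2 * (2 * m))%N by rewrite e; lia.
  rewrite height_periodicM ?hc -?e => [|t]; last by rewrite pa.
  by apply/eqP/eqP; lia.
by rewrite -e hc /r ko; apply/eqP/eqP; lia.
Qed.

Definition bit_set x : {set 'I_(2 * m)} := [set i : 'I_(2 * m) | bit x i].

Lemma bit_set_card x : admissible r (edges x) (mark x) -> twisted_loops x ->
  #|bit_set x| = m.
Proof.
move=> ad tl; have [_ _ h0] := coding_word_balanced sym_period_dvd ad.
apply/eqP; rewrite -(@balanced_bits (coding_word r (edges x) (mark x))) ?h0 //.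
  by move=> t; apply: coding_word_bit.
by move=> t; apply: bit_periodic.
Qed.

Lemma bit_set_inj x y : admissible r (edges x) (mark x) -> twisted_loops x ->
  admissible r (edges y) (mark y) -> twisted_loops y ->
  bit_set x = bit_set y -> x = y.
Proof.
move=> adx tlx ady tly /setP eb.
have ebit t : bit x t = bit y t.
  have m2 : (0 < 2 * m)%N by rewrite muln_gt0.
  have ex := periodic_mod (x := t) (y := t %% (2 * m)) (fun t => bit_periodic t adx tlx).
  have ey := periodic_mod (x := t) (y := t %% (2 * m)) (fun t => bit_periodic t ady tly).
  rewrite ex ?ey ?modn_mod //.
  by have := eb (Ordinal (ltn_pmod t m2)); rewrite !inE.
have ew t : coding_word r (edges x) (mark x) t = coding_word r (edges y) (mark y) t.
  by rewrite !coding_word_bit // !ebit.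
have [eE em] := coding_word_inj adx ady ew.
apply: conf_ext => [a b|a b|t nt]; rewrite ?eE ?/marked ?em //.
have := ebit t; rewrite /bit -ew.
have /eqP-> // : coding_word r (edges x) (mark x) t == 0.
by rewrite (orients_free (coding_word_orients adx)).
Qed.

(** The subset gives a periodic bit sequence [a], the word [a t + a (t + r) - 1]
    gives the matching and its mark, and the loops are read off from [a] at the
    vertices where this word is 0. *)
Lemma bit_set_surj (A : {set 'I_(2 * m)}) : #|A| = m ->
  exists x, [/\ admissible r (edges x) (mark x), twisted_loops x & bit_set x = A].
Proof.
move=> cA; have m2 : (0 < 2 * m)%N by rewrite muln_gt0.
pose a t := Ordinal (ltn_pmod t m2) \in A.
have amod t t' : t = t' %[mod 2 * m] -> a t = a t'.
  by move=> e; rewrite /a; congr (_ \in A); apply: val_inj.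
have aA (i : 'I_(2 * m)) : a i = (i \in A).
  by rewrite /a; congr (_ \in A); apply: val_inj; rewrite /= modn_small.
have apm t : a (t + 2 * m)%N = a t by apply: amod; rewrite modnDr.
have ap t : a (t + r + r)%N = a t.
  case: r2 => -[e _]; last by rewrite -addnA -e apm.
  by rewrite -e !apm.
pose s t : int := (a t)%:Z + (a (t + r)%N)%:Z - 1.
have bs : balanced r s.
  split=> [t|t|]; rewrite ?/s.
  - by case: (a t) (a (t + r)%N) => -[].
  - by rewrite ap; lia.
  apply/eqP; rewrite (balanced_bits (a := a)) //; apply/eqP; rewrite -[RHS]cA.
  by apply: eq_card => i; rewrite inE aA.
have [E [mk [ad ew]]] := coding_word_surj r0 sym_period_dvd bs.
pose L := [set i : 'I_N.+1 | ~~ matched E i && (a i (+) odd ((i + N) %/ N.+1))].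
have xP : is_NCCB (E, L, mk).
  have [mE mi _ _] := ad; have /and3P[h1 h2 h3] := mE.
  apply/and5P; split=> //; rewrite disjoint_subset; apply/subsetP => i.
  by rewrite !inE /matched valZpK => /andP[].
pose x : NCCB N.+1 := Sub (E, L, mk) xP.
have oE : orients E (coding_word r E mk) := coding_word_orients ad.
have su t : ~~ matched E t -> odd k /\ a (t + r)%N = ~~ a t.
  move=> nt; have /eqP : coding_word r E mk t == 0 by rewrite (orients_free oE).
  rewrite ew /s => e0; split; last by move: e0; case: (a t) (a (t + r)%N) => -[].
  by case: r2 => -[e //]; move: e0; rewrite -e apm; case: (a t).
have mshift := matched_shift _ (admissible_matching ad) (admissible_rot ad).
(* [N.+1] is an odd multiple of [m] when there are unmatched vertices. *)
have anti t : ~~ matched E t -> a (t + N.+1)%N = ~~ a t.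
  move=> nt; have [ko e1] := su t nt.
  have -> : (t + N.+1 = t + m + k./2 * (2 * m))%N.
    by rewrite nE [in LHS]kE ko mulnDr muln1 mulnCA addnA; lia.
  rewrite (amod _ (t + m)%N); first by rewrite -e1 /r ko.
  by rewrite addnC modnMDl.
have ls t : ~~ matched E t -> loop_state x t = a t.
  pose f u := ~~ matched E u && (loop_state x u (+) a u).
  have fper u : f (u + N.+1)%N = f u.
    rewrite /f (@matched_mod _ _ (u + N.+1) u) ?modnDr //.
    case: (boolP (matched E u)) => //= nu.
    by rewrite loop_state_antiperiodic (anti _ nu) addNb addbN negbK.
  have f0 u : f u = false.
    rewrite (periodic_mod (y := (u %% N.+1)%N) fper) ?modn_mod //.
    have := ltn_pmod u (ltn0Sn N); move: (u %% N.+1)%N => v vN.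
    rewrite /f; case: (boolP (matched E v)) => //= nv.
    have lv : (inZp v \in loops x) = a v (+) odd ((v + N) %/ N.+1).
      have -> : loops x = L by [].
      rewrite inE (_ : matched E _ = matched E v) ?nv.
        by have -> : (inZp v : 'I_N.+1) = v :> nat by apply: modn_small.
      by apply: matched_mod; rewrite /= modn_mod.
    by rewrite /loop_state lv; case: (a v); case: odd.
  by move=> nt; have := f0 t; rewrite /f nt /=; case: loop_state (a t) => -[].
exists x; split=> //.
- by move=> t nt; have [ko e] := su t nt; split; rewrite ?ls ?mshift.
apply/setP => i; rewrite inE /bit -aA ew.
have [mt|nt] := boolP (matched E i).
  have := orients_free oE i; rewrite mt ew => /negbT/eqP; rewrite /s.
  by case: (a i) (a (i + r)%N) => -[].
have /eqP : coding_word r E mk i == 0 by rewrite (orients_free oE).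
by rewrite ew => -> /=; rewrite ls.
Qed.

(** By [bit_set], the fixed configurations are the [m]-element subsets of [2 * m]
    positions. For [k = 1] the power of the twist is the identity. *)
Lemma card_twist_fix :
  #|[set x : NCCB N.+1 | (twist hn ^+ (2 * m))%g x == x]| = 'C(2 * m, m).
Proof.
rewrite -[in 'C(_, _)](card_ord (2 * m)) -card_draws.
rewrite -(@card_in_imset _ _ bit_set) => [|x y]; last first.
  rewrite !inE => /twist_fix_sym[adx tlx] /twist_fix_sym[ady tly].
  exact: bit_set_inj.
congr #|pred_of_set _|; apply/setP => A; rewrite inE.
apply/imsetP/eqP => [[x]|/bit_set_surj[x [ad tl <-]]].
  by rewrite inE => /twist_fix_sym[ad tl] ->; apply: bit_set_card.
by exists x => //; rewrite inE; apply/twist_fix_sym.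
Qed.

End Counting.

(** * The cyclic sieving statement *)

Lemma perm_fix_expg (T : finType) (p : {perm T}) k x :
  p x = x -> (p ^+ k)%g x = x.
Proof. by move=> px; elim: k => [|k IH]; rewrite ?perm1 // expgSr permM IH. Qed.

(** By Bezout, each of the two powers is a power of the other one. *)
Lemma perm_fix_gcdn (T : finType) (p : {perm T}) n c x : (0 < c)%N ->
  (p ^+ n = 1)%g -> ((p ^+ c)%g x == x) = ((p ^+ gcdn c n)%g x == x).
Proof.
move=> c0 pn; apply/eqP/eqP => px.
  have [u v uv _] := egcdnP n c0.
  have := perm_fix_expg u px; rewrite -expgM mulnC uv expgD mulnC expgM pn.
  by rewrite expg1n mul1g.
have := perm_fix_expg (c %/ gcdn c n) px; rewrite -expgM muln_divA ?dvdn_gcdl //.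
by rewrite mulKn ?gcdn_gt0 ?c0.
Qed.

(** On both sides the exponent matters only modulo [n]. *)
Lemma expz_nat_exponent (gT : finGroupType) (g : gT) (F : fieldType) (z : F) n d :
  (0 < n)%N -> (g ^+ n = 1)%g -> z ^+ n = 1 ->
  exists c, [/\ (0 < c)%N, expg_int g d = (g ^+ c)%g & z ^ d = z ^+ c].
Proof.
move=> n0 gn zn; case: d => k /=.
  exists (k + n)%N; split; first by rewrite addn_gt0 n0 orbT.
    by rewrite expgD gn mulg1.
  by rewrite exprD zn mulr1.
exists (k.+1 * n.-1 + n)%N; split; first by rewrite addn_gt0 n0 orbT.
  rewrite expgD gn mulg1; apply: (mulgI (g ^+ k.+1)%g).
  by rewrite mulgV -expgD -mulnS prednK // mulnC expgM gn expg1n.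
rewrite exprD zn mulr1.
have e : z ^+ k.+1 * z ^+ (k.+1 * n.-1) = 1.
  by rewrite -exprD -mulnS prednK // mulnC exprM zn expr1n.
rewrite NegzE -exprnN; apply: (mulfI (x := z ^+ k.+1)).
  by apply/eqP => z0; move: e; rewrite z0 mul0r => /esym/eqP; rewrite oner_eq0.
rewrite e mulfV //.
by apply/eqP => z0; move: e; rewrite z0 mul0r => /esym/eqP; rewrite oner_eq0.
Qed.

Lemma central_binom_lt a b : (a < b)%N -> ('C(2 * a, a) < 'C(2 * b, b))%N.
Proof.
have step c : ('C(2 * c, c) < 'C(2 * c.+1, c.+1))%N.
  have -> : (2 * c.+1 = (2 * c).+2)%N by lia.
  have le : ('C(2 * c, c) <= 'C((2 * c).+1, c))%N.
    by case: c => // c; rewrite binS leq_addr.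
  rewrite binS addnC (leq_ltn_trans le) // -[ltnLHS]addn0 ltn_add2l bin_gt0; lia.
elim: b => // b IH; rewrite ltnS leq_eqVlt => /orP[/eqP-> //|/IH lt].
exact: ltn_trans lt (step b).
Qed.

Lemma twist_expg N (hn : (0 < N.+1)%N) : (twist hn ^+ (2 * N.+1) = 1)%g.
Proof.
apply/permP => x; rewrite perm1; apply/eqP/twist_fixP.
have e t : t = (t + 2 * N.+1)%N %[mod N.+1] by rewrite addnC modnMDl.
split=> [a b|a b|t _].
- exact: chord_mod (esym (e a)) (esym (e b)).
- by rewrite /marked -(inZp_mod (e a)) -(inZp_mod (e b)).
by rewrite mulSn mul1n addnA !loop_state_antiperiodic negbK.
Qed.

Lemma cycle_actionE (X : finType) (s p : {perm X}) x : cycle_action s x p = p x.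
Proof. by []. Qed.

(** The power [d] has the fixed points of the power [gcdn d n], and the primitive
    root raised to [d] is primitive of the complementary order; so it suffices to
    consider exponents that divide [n]. *)
Lemma cyclic_sieving_cycle (R : realType) (X : finType) (p : {perm X}) n
    (f : {poly int}) : (0 < n)%N -> #[p]%g = n -> (forall i, 0 <= f`_i) ->
  (forall (z : R[i]) m k, n = (m * k)%N -> k.-primitive_root z ->
     #|[set x | (p ^+ m)%g x == x]|%:R = (map_poly intr f).[z]) ->
  cyclic_sieving R n p (cycle_action p) f.
Proof.
move=> n0 op f0 h; split=> // xi prxi d.
have pn : (p ^+ n = 1)%g by rewrite -op expg_order.
have [c [c0 -> ->]] := expz_nat_exponent d n0 pn (prim_expr_order prxi).
have nE : n = (gcdn c n * (n %/ gcdn c n))%N by rewrite mulnC divnK // dvdn_gcdr.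
rewrite -(h _ _ _ nE (exp_prim_root prxi c)); congr (_%:R); apply: eq_card => x.
rewrite [LHS]in_set [RHS]in_set cycle_actionE; exact: perm_fix_gcdn.
Qed.

Theorem theorem5 (R : realType) (n : nat) (hn : (0 < n)%N) :
  cyclic_sieving R n (twist hn ^+ 2)%g (cycle_action (twist hn ^+ 2)%g)
    (qbinom (2 * n) n).
Proof.
case: n hn => [//|N] hn.
have cardfix m k : N.+1 = (m * k)%N ->
    #|[set x | ((twist hn ^+ 2) ^+ m)%g x == x]| = 'C(2 * m, m).
  by move=> e; rewrite -(card_twist_fix hn e) -expgM.
have gn : ((twist hn ^+ 2) ^+ N.+1 = 1)%g by rewrite -expgM twist_expg.
apply: cyclic_sieving_cycle => // [|i|z m k nE prz].
- move: gn cardfix; move: (twist hn ^+ 2)%g => g gn cardfix.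
  (* If the order were a proper divisor, both [g ^+ #[g]] and [g ^+ N.+1] would
     fix everything, with different numbers of fixed points. *)
  have dv : (#[g]%g %| N.+1)%N by rewrite order_dvdn gn.
  have le := dvdn_leq (ltn0Sn N) dv; have /dvdnP[k nE] := dv.
  rewrite mulnC in nE.
  have fixT l : (g ^+ l = 1)%g -> [set x | (g ^+ l)%g x == x] = setT.
    by move=> ->; apply/setP => x; rewrite !inE perm1 eqxx.
  have := cardfix _ _ nE; rewrite (fixT _ (expg_order g)).
  rewrite -(fixT _ gn) (cardfix N.+1 1%N) ?muln1 // => eqC.
  move: le; rewrite leq_eqVlt => /orP[/eqP //|/central_binom_lt].
  by rewrite eqC ltnn.
- by rewrite qbinom_gauss ?gauss_binom_ge0 //; lia.
rewrite (cardfix m k nE) qbinom_gauss; last by lia.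
by rewrite nE mulnA horner_gauss_binom_mul.
Qed.
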